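(* Let $\sigma_1,\omega_1\in S_{n_1}$ and $\sigma_2,\omega_2\in S_{n_2}$ be two pairs of permutations. Suppose that there is an isomorphism $\phi$ of directed graphs from the Bruhat interval $G[\sigma_1,\omega_1]$ to the Bruhat interval $G[\sigma_2,\omega_2]$. Suppose further that there is a strictly increasing map $\gamma:\{1,\ldots,n_1\}\to\{1,\ldots,n_2\}$ such that the following property holds: for any edge $\sigma_1\leq z<(i,j)z\leq\omega_1$ with $1\leq i<j\leq n_1$, so that $\phi((i,j)z)=(i',j')\phi(z)$ with $1\leq i'<j'\leq n_2$, we have $j'=\gamma(j)$. Then the equality $P_{\sigma_1,\omega_1}=P_{\sigma_2,\omega_2}$ of Kazhdan-Lusztig polynomials holds.
   Context: $S_n$ is the Coxeter group with generators the simple transpositions $(i,i+1)$, $1\le i\le n-1$; its reflections are the transpositions $(i,j)$. $\ell$ is the length, $\leq$ the Bruhat order, permutations compose right to left. $P_{\sigma,\omega}\in\mathbb{Z}[q]$ is the usual Kazhdan-Lusztig polynomial. The Bruhat interval $G[\sigma,\omega]$ is the directed graph with vertices all $z$ with $\sigma\leq z\leq\omega$ and edges the pairs $(z_1,z_2)$ of vertices such that $z_2z_1^{-1}$ is a reflection and $\ell(z_1)<\ell(z_2)$. An isomorphism of directed graphs is a bijection of vertices such that $(z,z')$ is an edge iff $(\phi(z),\phi(z'))$ is an edge. *)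

(* Defs.v *)
From Stdlib Require Import ClassicalEpsilon.
From mathcomp Require Import all_boot all_order all_fingroup all_algebra.
Set Implicit Arguments.
Unset Strict Implicit.
Unset Printing Implicit Defensive.

Import GRing.Theory.
Local Open Scope group_scope.

(* Products in ['S_n] compose left to right: [(s * t) x = t (s x)].  In the  *)
(* right-to-left convention, "t z" is therefore [z * t] here and             *)
(* "z2 z1^-1" is [z1^-1 * z2].  Indices run over {0, ..., n-1}.              *)

Definition simples (n : nat) : {set 'S_n} :=
  [set tperm p.1 p.2 | p : 'I_n * 'I_n & p.2 == p.1.+1 :> nat].

Definition reflections (n : nat) : {set 'S_n} :=
  [set tperm p.1 p.2 | p : 'I_n * 'I_n & (p.1 < p.2)%N].

Lemma tperm_simples (n : nat) (i j : 'I_n) : tperm i j \in <<simples n>>.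
Proof.
wlog lt_ij : i j / (i < j)%N.
  move=> IH; case: (ltngtP i j) => [|gt_ij|/val_inj ->]; first exact: IH.
    by rewrite tpermC; apply: IH.
  by rewrite tperm1 group1.
have [k] := ubnP (val j); elim: k j lt_ij => // k IH j lt_ij lt_jk.
have [def_j | neq_j] := eqVneq (j : nat) i.+1.
  by apply/mem_gen/imsetP; exists (i, j); rewrite ?inE //= def_j.
have j_gt0 : (0 < j)%N by apply: leq_ltn_trans lt_ij.
have lt_j1n : (j.-1 < n)%N by apply: leq_ltn_trans (leq_pred j) (ltn_ord j).
pose j1 := Ordinal lt_j1n.
have lt_ij1 : (i < j1)%N.
  by rewrite /= -ltnS prednK // ltn_neqAle eq_sym neq_j.
have lt_j1j : (j1 < j)%N by rewrite /= prednK.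
have lt_j1k : (j1 < k)%N by apply: leq_trans lt_j1j _.
have sim_j : tperm j1 j \in <<simples n>>.
  by apply/mem_gen/imsetP; exists (j1, j); rewrite ?inE //= prednK.
have -> : tperm i j = tperm i j1 ^ tperm j1 j.
  rewrite tpermJ tpermL tpermD //; apply/eqP => /(congr1 val) def_i.
    by rewrite -def_i ltnn in lt_ij1.
  by rewrite -def_i ltnn in lt_ij.
by rewrite groupJ // IH.
Qed.

Lemma simples_exp_ex (n : nat) (w : 'S_n) : exists k, w \in simples n ^+ k.
Proof.
have : w \in <<simples n>>.
  have [ts -> _] := prod_tpermP w.
  by apply: group_prod => t _; apply: tperm_simples.
case/gen_prodgP=> k [c c_simple ->]; exists k.
elim: k c c_simple => [|k IH] c c_simple.
  by rewrite big_ord0 expg0 set11.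
rewrite big_ord_recl expgS; apply: mem_mulg => //.
by apply: IH => i.
Qed.

(* [simples n ^+ k] is the set of products of [k] simple transpositions.     *)
Definition length (n : nat) (w : 'S_n) : nat := ex_minn (simples_exp_ex w).

Definition refl_lt (n : nat) : rel 'S_n :=
  fun z1 z2 => (z1^-1 * z2 \in reflections n) && (length z1 < length z2)%N.

(* [connect] is the reflexive transitive closure.                            *)
Definition bruhat (n : nat) : rel 'S_n := connect (@refl_lt n).

Definition interval (n : nat) (u v : 'S_n) : {set 'S_n} :=
  [set z | bruhat u z && bruhat z v].

Definition bruhat_graph (n : nat) (u v : 'S_n) : rel 'S_n :=
  fun z1 z2 =>
    [&& z1 \in interval u v, z2 \in interval u v & refl_lt z1 z2].

(* [phi] is a map on the whole group; only its values on the interval count. *)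
Definition is_graph_iso (n1 n2 : nat) (s1 w1 : 'S_n1) (s2 w2 : 'S_n2)
    (phi : 'S_n1 -> 'S_n2) : Prop :=
  [/\ phi @: interval s1 w1 = interval s2 w2,
      {in interval s1 w1 &, injective phi}
    & {in interval s1 w1 &, forall z z',
        bruhat_graph s1 w1 z z' = bruhat_graph s2 w2 (phi z) (phi z')}].

Definition descent (n : nat) (v s : 'S_n) : bool :=
  (s \in simples n) && (length (v * s) < length v)%N.

Local Open Scope ring_scope.

(* The R-polynomials and the Kazhdan-Lusztig polynomials are each defined as *)
(* the unique family satisfying a list of conditions; the variable q is 'X.  *)

Definition R_family (n : nat) (R : 'S_n -> 'S_n -> {poly int}) : Prop :=
  [/\ forall u v, ~~ bruhat u v -> R u v = 0,
      forall u, R u u = 1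
    & forall u v s : 'S_n, descent v s ->
        R u v = if descent u s then R (u * s)%g (v * s)%g
                else 'X * R (u * s)%g (v * s)%g
                     + ('X - 1) * R u (v * s)%g].

Definition Rpoly (n : nat) : 'S_n -> 'S_n -> {poly int} :=
  epsilon (inhabits (fun _ _ => 0)) (@R_family n).

(* q^d p(1/q), for [p] of degree at most [d].                                *)
Definition reversal (d : nat) (p : {poly int}) : {poly int} :=
  \poly_(i < d.+1) p`_(d - i).

(* As [size p] is [deg p + 1], the third condition reads                     *)
(* [2 * deg (P u v) <= length v - length u - 1].                             *)
Definition KL_family (n : nat) (P : 'S_n -> 'S_n -> {poly int}) : Prop :=
  [/\ forall u v, ~~ bruhat u v -> P u v = 0,
      forall u, P u u = 1,
      forall u v, bruhat u v -> u != v ->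
        ((size (P u v)).-1.*2 < length v - length u)%N
    & forall u v, bruhat u v ->
        reversal (length v - length u) (P u v)
          = \sum_(a in interval u v) Rpoly u a * P a v].

Definition KLpoly (n : nat) : 'S_n -> 'S_n -> {poly int} :=
  epsilon (inhabits (fun _ _ => 0)) (@KL_family n).

(* Main.v *)
(* R-polynomials are computed by Dyer's formula for the reflection order that *)
(* compares the transpositions (i, j), i < j, by j first and then by i:       *)
(* R~_{u,v} = sum of x^k over the upward paths of length k from u to v with   *)
(* increasing labels.  As a product of operators f |-> f + x f(_ t), one for  *)
(* each reflection t in increasing order, the right-hand side satisfies the   *)
(* recursion of the R-polynomials by the braid relation for these operators,  *)
(* and so does its inverse with x replaced by -x.  The two therefore agree,   *)
(* and this is the inversion formula from which the Kazhdan-Lusztig           *)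
(* polynomials are built.                                                     *)
(* The labels (i, j) matter only through the relation "increasing" between    *)
(* two consecutive edges.  If their indices j differ, it is preserved because *)
(* gamma is increasing.  If they coincide, the two edges a -> b -> c have a   *)
(* companion a -> b' -> c whose indices are (j, < j) when the labels increase *)
(* and (< j, j) when they decrease, which again can be seen through gamma.    *)
(* Hence phi preserves all R~_{u,v}, so it preserves the Bruhat order         *)
(* (R~ <> 0), the length differences (degree of R~), and the polynomials P.   *)

Require Import Defs.
From Stdlib Require Import ClassicalEpsilon.
From mathcomp Require Import all_boot all_order all_fingroup all_algebra.
From mathcomp Require Import ring zify.
Set Implicit Arguments.
Unset Strict Implicit.
Unset Printing Implicit Defensive.

Import GRing.Theory.
Local Open Scope group_scope.

(* [interval] alone denotes MathComp's type of intervals.                    *)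
Local Notation interval := Defs.interval.

(** * Inversions and length *)

(** An edge [u -> u * swap p] carries the pair [p] of values that it exchanges, and R~ counts, by
    length, the paths whose labels increase in the column order. [twisted_revlex] says how the
    product of the edge operators passes an adjacent transposition; evaluated on a delta function,
    this is the recursion of R~ ([word_poly_recursion]), which determines it. Each operator is
    inverted by c -> -c, so the same relation yields the inversion formula [word_poly_inverse].
    Putting x = q^(1/2) - q^(-1/2) identifies [Rpoly] ([Rpoly_dehom]), and the inversion formula
    makes the defining equation of the Kazhdan-Lusztig polynomials solvable ([reversal_KLrec]).

    To compare two intervals, [word_poly_transport] follows increasing paths vertex by vertex;
    besides the graph isomorphism it only needs to know whether two consecutive labels increase.
    Columns alone decide this when they differ. Otherwise [same_column_increasing] replaces the
    comparison of rows by the existence of a second path with the same ends and a prescribed order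
    of columns, and this path stays in the interval by convexity. Once R~ is transported, its
    nonvanishing and its degree recover the Bruhat order and the length differences, and
    [KLpoly_transport] follows by uniqueness of the solution ([reversal_unique]). *)

Definition rising n (u : 'S_n) (p : 'I_n * 'I_n) : bool :=
  (u^-1 p.1 < u^-1 p.2)%N.

Definition swap n (p : 'I_n * 'I_n) : 'S_n := tperm p.1 p.2.

Lemma swapK n (u : 'S_n) (p : 'I_n * 'I_n) : u * swap p * swap p = u.
Proof. by rewrite -mulgA tperm2 mulg1. Qed.

Lemma pos_swap n (u : 'S_n) (p : 'I_n * 'I_n) (i : 'I_n) :
  (u * swap p)^-1 i = u^-1 (swap p i).
Proof. by rewrite invMg tpermV permM. Qed.

Lemma rising_swap n (u : 'S_n) (p : 'I_n * 'I_n) :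
  p.1 != p.2 -> rising (u * swap p) p = ~~ rising u p.
Proof.
move=> ne; rewrite /rising !pos_swap /swap tpermL tpermR -leqNgt ltn_neqAle.
suff -> : (u^-1 p.2 != u^-1 p.1 :> nat) by [].
by rewrite val_eqE (inj_eq perm_inj) eq_sym.
Qed.

(** Indexed by values rather than positions, because [u * swap p] exchanges two values. *)
Definition inversions n (u : 'S_n) : {set 'I_n * 'I_n} :=
  [set p : 'I_n * 'I_n | (p.1 < p.2)%N && (u^-1 p.2 < u^-1 p.1)%N].

Lemma tperm_adjacent_lt n (i j x y : 'I_n) :
  j = i.+1 :> nat -> (x < y)%N -> (x, y) != (i, j) ->
  (tperm i j x < tperm i j y)%N.
Proof.
move=> ij xy; rewrite xpair_eqE -!val_eqE /=.
have neq (z t : 'I_n) : z <> t -> z <> t :> nat by move=> zt /val_inj.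
by case: tpermP => [xE|xE|/neq xi /neq xj]; case: tpermP => [yE|yE|/neq yi /neq yj];
  subst; lia.
Qed.

(** An adjacent transposition keeps the order of every pair of values except [(i, j)], so it carries
    old inversions to new ones and adds only [(i, j)]. *)
Lemma card_inversions_adjacent n (u : 'S_n) (i j : 'I_n) :
  j = i.+1 :> nat -> rising u (i, j) ->
  #|inversions (u * swap (i, j))| = #|inversions u|.+1.
Proof.
move=> ij up.
have ij_ne : i != j by rewrite -val_eqE /= ij; lia.
have -> : inversions (u * swap (i, j)) =
    (i, j) |: [set (swap (i, j) p.1, swap (i, j) p.2) | p in inversions u].
  apply/setP=> -[x y]; rewrite !inE /= xpair_eqE !pos_swap.
  apply/idP/idP => [/andP[xy xyv]|/orP[]].
  - have [//|ne /=] := boolP ((x == i) && (y == j)).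
    apply/imsetP; exists (swap (i, j) x, swap (i, j) y);
      rewrite ?inE /= ?xyv ?andbT ?tpermK //.
    by apply: tperm_adjacent_lt.
  - case/andP=> /eqP -> /eqP ->; rewrite /swap tpermL tpermR ij leqnn.
    exact: up.
  case/imsetP=> -[a b]; rewrite inE /= => /andP[ab abv] [-> ->].
  rewrite /swap !tpermK abv andbT; apply: tperm_adjacent_lt => //.
  by apply: contraTneq abv => -[-> ->]; rewrite -leqNgt ltnW.
rewrite cardsU1 card_imset; last first.
  by move=> [a b] [a' b'] [/perm_inj -> /perm_inj ->].
suff -> : (i, j) \notin [set (swap (i, j) p.1, swap (i, j) p.2) |
                          p in inversions u] by [].
apply/imsetP=> -[[a b]]; rewrite inE /= => /andP[ab _] [ai bj].
move: ab; rewrite -[a](tpermK i j) -[b](tpermK i j).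
by move: ai bj; rewrite /swap /= => <- <-; rewrite tpermL tpermR ij; lia.
Qed.

Lemma simplesP n (s : 'S_n) :
  reflect (exists2 p : 'I_n * 'I_n, p.2 = p.1.+1 :> nat & s = swap p)
          (s \in simples n).
Proof.
by apply: (iffP imsetP) => -[p]; [rewrite inE => /eqP | ] => pE ->; exists p;
  rewrite ?inE ?pE.
Qed.

Lemma inversions_simple_leq n (u s : 'S_n) :
  s \in simples n -> (#|inversions (u * s)| <= #|inversions u|.+1)%N.
Proof.
case/simplesP=> -[i j] /= ij ->.
have ne : (i, j).1 != (i, j).2 by rewrite /= -val_eqE /= ij; lia.
have [up|dn] := boolP (rising u (i, j)).
  by rewrite card_inversions_adjacent.
have up : rising (u * swap (i, j)) (i, j) by rewrite rising_swap.
have := card_inversions_adjacent ij up.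
by rewrite swapK => ->; apply: leqW.
Qed.

Lemma inversions1 n : inversions (1 : 'S_n) = set0.
Proof.
apply/setP=> p; rewrite !inE invg1 !perm1; apply/negbTE.
by rewrite negb_and -!leqNgt leq_total.
Qed.

Lemma exists_adjacent_drop n (u : 'S_n) :
  u != 1 -> exists2 p : 'I_n * 'I_n, p.2 = p.1.+1 :> nat & ~~ rising u p.
Proof.
move=> u_ne1; pose Q (p : 'I_n * 'I_n) := (p.2 == p.1.+1 :> nat) && ~~ rising u p.
have [/existsP[p /andP[/eqP p12 p_dn]]|] := boolP [exists p, Q p]; first by exists p.
move/existsPn=> allup; case/eqP: u_ne1.
have up (i j : 'I_n) : j = i.+1 :> nat -> (u^-1 i < u^-1 j)%N.
  by move=> ij; have := allup (i, j); rewrite /Q /= ij eqxx /= negbK.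
(* [u^-1] is strictly increasing, hence lies above the identity; equality then follows by induction
   from the largest index downwards. *)
have lo (i : 'I_n) : (i <= u^-1 i)%N.
  case: i => i; elim: i => [|i IH] i_lt //=.
  by apply: leq_ltn_trans (IH (ltnW i_lt)) _; apply: up.
have eq_id (k : nat) : forall i : 'I_n, (n - i <= k)%N -> u^-1 i = i.
  elim: k => [|k IH] i ik; first by have := ltn_ord i; rewrite -subn_gt0 ltnNge ik.
  apply/val_inj/eqP; rewrite eqn_leq lo andbT leqNgt; apply/negP=> lt_i.
  have lt_k : (n - u^-1 i <= k)%N.
    by rewrite -ltnS; apply: leq_trans ik; rewrite ltn_sub2l.
  have /perm_inj eq_i := IH _ lt_k.
  by rewrite eq_i ltnn in lt_i.
by apply: invg_inj; apply/permP=> i; rewrite invg1 perm1 (eq_id n) ?leq_subr.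
Qed.

Lemma inversions_leq_word n k (u : 'S_n) :
  u \in simples n ^+ k -> (#|inversions u| <= k)%N.
Proof.
elim: k u => [|k IH] u; first by rewrite expg0 => /set1gP ->; rewrite inversions1 cards0.
rewrite expgSr => /mulsgP[v s vk ss ->].
by apply: leq_trans (inversions_simple_leq _ ss) _; rewrite ltnS IH.
Qed.

Lemma word_of_inversions n (u : 'S_n) : u \in simples n ^+ #|inversions u|.
Proof.
have [k] := ubnP #|inversions u|; elim: k u => // k IH u lt_uk.
have [->|/exists_adjacent_drop[p p12 dn]] := eqVneq u 1.
  by rewrite inversions1 cards0 expg0 set11.
have p_ne : p.1 != p.2 by rewrite -val_eqE /=; lia.
have up : rising (u * swap p) p by rewrite rising_swap.
case: p p12 dn p_ne up => i j p12 dn p_ne up.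
have := card_inversions_adjacent p12 up; rewrite swapK => inv_u.
rewrite inv_u expgSr -[X in X \in _](swapK u (i, j)) mem_mulg //.
  by apply: IH; rewrite inv_u in lt_uk; lia.
by apply/simplesP; exists (i, j).
Qed.

Lemma length_inversions n (u : 'S_n) : length u = #|inversions u|.
Proof.
rewrite /length; case: ex_minnP => k uk kmin; apply/eqP.
by rewrite eqn_leq inversions_leq_word // kmin // word_of_inversions.
Qed.

Lemma length1 n : length (1 : 'S_n) = 0%N.
Proof. by rewrite length_inversions inversions1 cards0. Qed.

Lemma length_adjacent_up n (u : 'S_n) (p : 'I_n * 'I_n) :
  p.2 = p.1.+1 :> nat -> rising u p -> length (u * swap p) = (length u).+1.
Proof. by case: p => i j ij up; rewrite !length_inversions card_inversions_adjacent. Qed.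

Lemma length_adjacent n (u : 'S_n) (p : 'I_n * 'I_n) :
  p.2 = p.1.+1 :> nat ->
  if rising u p then length (u * swap p) = (length u).+1
  else length u = (length (u * swap p)).+1.
Proof.
move=> p12; case: ifPn => [|dn]; first exact: length_adjacent_up.
rewrite -{1}(swapK u p) length_adjacent_up // rising_swap //.
by rewrite -val_eqE /=; lia.
Qed.

Lemma swap_conj n (i j k : 'I_n) : i != j -> i != k ->
  swap (i, k) = swap (j, k) * swap (i, j) * swap (j, k).
Proof.
move=> ij ik; rewrite /swap /= -{1}(tpermV j k) -mulgA -/(_ ^ _) tpermJ tpermL.
by rewrite tpermD // eq_sym.
Qed.

(** Conjugation by the adjacent pair (k-1, k) reduces (i, k) to (i, k-1). The middle factor raises
    the length by induction, the outer ones change it by one each, and they cannot both lower it. *)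
Lemma length_swap_up n (u : 'S_n) (p : 'I_n * 'I_n) :
  (p.1 < p.2)%N -> rising u p -> (length u < length (u * swap p))%N.
Proof.
case: p => i k /=; have [m] := ubnP (k : nat); elim: m k u => // m IH k u lt_km lt_ik up.
have [k_i|k_ni] := eqVneq (k : nat) i.+1; first by rewrite length_adjacent_up.
have j_lt : (k.-1 < n)%N by have := ltn_ord k; lia.
pose j := Ordinal j_lt.
have jk : (j, k).2 = (j, k).1.+1 :> nat by rewrite /=; lia.
have ij : i != j by rewrite -val_eqE /=; lia.
have ik : i != k by rewrite -val_eqE /=; lia.
have kj : k != j by rewrite -val_eqE /=; lia.
have up' : rising (u * swap (j, k)) (i, j).
  by rewrite /rising /= !pos_swap /swap /= tpermL tpermD // eq_sym.
have := IH j (u * swap (j, k)) ltac:(rewrite /=; lia) ltac:(rewrite /=; lia) up'.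
rewrite (swap_conj ij ik) !mulgA.
set v := u * swap (j, k) * swap (i, j).
have := length_adjacent u jk; have := length_adjacent v jk.
have : ~~ rising v (j, k) -> rising u (j, k).
  rewrite /rising /v /= !pos_swap /swap /=.
  have [jk' ji ki] : [/\ j != k, j != i & k != i] by split; rewrite eq_sym.
  rewrite tpermR (tpermD ik jk') (tpermD ji ki) tpermR.
  by move: up; rewrite /rising /=; lia.
move: (length u) (length v) (length (u * _)) (length (v * _)) => a b d e.
by case: (rising v _); case: (rising u _) => //; lia.
Qed.

Lemma length_swap n (u : 'S_n) (p : 'I_n * 'I_n) :
  (p.1 < p.2)%N -> (length u < length (u * swap p))%N = rising u p.
Proof.
move=> p12; have [up|dn] := boolP (rising u p); first by rewrite length_swap_up.
have := @length_swap_up _ (u * swap p) p p12.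
rewrite swapK rising_swap ?dn => [/(_ isT) lt|]; first by rewrite ltnNge ltnW // (negbTE dn).
by rewrite -val_eqE neq_ltn p12.
Qed.

Lemma odd_length n (u : 'S_n) : odd (length u) = odd_perm u.
Proof.
rewrite length_inversions; have [k] := ubnP #|inversions u|.
elim: k u => // k IH u lt_uk.
have [->|/exists_adjacent_drop[p p12 dn]] := eqVneq u 1.
  by rewrite inversions1 cards0 odd_perm1.
have p_ne : p.1 != p.2 by rewrite -val_eqE /=; lia.
have up : rising (u * swap p) p by rewrite rising_swap.
case: p p12 dn p_ne up => i j p12 dn p_ne up.
have := card_inversions_adjacent p12 up; rewrite swapK => inv_u.
rewrite inv_u /= IH; last by rewrite inv_u in lt_uk; lia.
by rewrite odd_permM odd_tperm p_ne addbT negbK.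
Qed.

Lemma reflectionsP n (t : 'S_n) :
  reflect (exists2 p : 'I_n * 'I_n, (p.1 < p.2)%N & t = swap p)
          (t \in reflections n).
Proof. by apply: (iffP imsetP) => -[p]; rewrite ?inE => pE ->; exists p; rewrite ?inE. Qed.

Lemma refl_lt_swap n (u : 'S_n) (p : 'I_n * 'I_n) :
  (p.1 < p.2)%N -> refl_lt u (u * swap p) = rising u p.
Proof.
move=> p12; rewrite /refl_lt length_swap // mulKg andb_idl // => _.
by apply/reflectionsP; exists p.
Qed.

Lemma refl_ltP n (u v : 'S_n) :
  reflect (exists p : 'I_n * 'I_n, [/\ (p.1 < p.2)%N, rising u p & v = u * swap p])
          (refl_lt u v).
Proof.
apply: (iffP idP) => [uv|[p [p12 up ->]]]; last by rewrite refl_lt_swap.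
have [/reflectionsP[p p12 uvp] _] := andP uv.
have vE : v = u * swap p by rewrite -uvp mulKVg.
by exists p; split=> //; rewrite -refl_lt_swap // -vE.
Qed.

Lemma swap_inj n (p q : 'I_n * 'I_n) :
  (p.1 < p.2)%N -> (q.1 < q.2)%N -> swap p = swap q -> p = q.
Proof.
case: p q => i j [a b] /= ij ab /permP/(_ i); rewrite /swap /= tpermL.
case: tpermP => [-> -> //|ia ja|_ _ ji]; first by move: ij ab; rewrite ia ja; lia.
by rewrite ji ltnn in ij.
Qed.

(** * Operators attached to reflections *)

Section Operators.
Variables (R : comNzRingType) (n : nat).
Implicit Types (c : R) (f g : {ffun 'S_n -> R}) (p q : 'I_n * 'I_n).
Implicit Types (W : seq ('I_n * 'I_n)) (u v s : 'S_n).

Local Open Scope ring_scope.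

Definition edge_op c p f : {ffun 'S_n -> R} :=
  [ffun u => f u + (if rising u p then c * f (u * swap p)%g else 0)].

(** The head of [W] is the outermost operator. Applied to [delta v] and evaluated at [u], the word
    has one term per rising path from [u] to [v] whose labels form a subword of [W], read in
    order. *)
Definition word_op c W f := foldr (edge_op c) f W.

Definition shift s f : {ffun 'S_n -> R} := [ffun u => f (u * s)%g].

Definition delta v : {ffun 'S_n -> R} := [ffun u => (u == v)%:R].

Lemma word_op_cat c W1 W2 f : word_op c (W1 ++ W2) f = word_op c W1 (word_op c W2 f).
Proof. exact: foldr_cat. Qed.

Lemma shiftK p : involutive (shift (swap p)).
Proof. by move=> f; apply/ffunP=> u; rewrite !ffunE swapK. Qed.

Lemma shift_edge_op c s p f :
  shift s (edge_op c p f) = edge_op c (s^-1 p.1, s^-1 p.2)%g (shift s f).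
Proof.
apply/ffunP=> u; rewrite !ffunE /rising /= invMg !permM; congr (_ + _).
case: ifP => // _; congr (_ * f _).
have -> : swap (s^-1 p.1, s^-1 p.2)%g = (s * swap p * s^-1)%g.
  by rewrite /swap /= -tpermJ conjgE invgK mulgA.
by rewrite !mulgA mulgKV.
Qed.

Lemma edge_op_comm c p q f :
  p.1 != q.1 -> p.1 != q.2 -> p.2 != q.1 -> p.2 != q.2 ->
  edge_op c p (edge_op c q f) = edge_op c q (edge_op c p f).
Proof.
move=> h11 h12 h21 h22; apply/ffunP=> u; rewrite !ffunE /rising !pos_swap /swap.
rewrite !tpermD // 1?eq_sym //.
have -> : (u * tperm p.1 p.2 * tperm q.1 q.2 = u * tperm q.1 q.2 * tperm p.1 p.2)%g.
  rewrite -!mulgA; congr (u * _)%g; apply/commgP/conjg_fixP.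
  by rewrite tpermJ !tpermD // 1?eq_sym.
by case: ifP => _; case: ifP => _; ring.
Qed.

(* The identity depends only on the relative order of the positions of i, j, *)
(* k in the argument, so the order of the values i, j, k is irrelevant.      *)
Lemma edge_op_braid c (i j k : 'I_n) f : i != j -> i != k -> j != k ->
  edge_op c (i, j) (edge_op c (i, k) (edge_op c (j, k) f)) =
  edge_op c (j, k) (edge_op c (i, k) (edge_op c (i, j) f)).
Proof.
move=> ij ik jk; have [ji ki kj] : [/\ j != i, k != i & k != j] by split; rewrite eq_sym.
apply/ffunP=> u; rewrite !ffunE /rising /= !pos_swap /swap /=.
rewrite !(tpermL, tpermR, tpermD ik jk, tpermD ij kj, tpermD ji ki).
have tC (x y z : 'I_n) : x != z -> y != z ->
    (tperm x y * tperm y z = tperm x z * tperm x y)%g.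
  by move=> xz yz; rewrite conjgCV tpermV tpermJ tpermR tpermD.
have e1 : (u * tperm j k * tperm i k = u * tperm i j * tperm j k)%g.
  by rewrite -!mulgA (tpermC i k) tC // (tpermC j i).
have e2 : (u * tperm i k * tperm i j = u * tperm i j * tperm j k)%g.
  by rewrite -!mulgA (tC i j k) // (tpermC i k).
have e3 : (u * tperm i k * tperm j k = u * tperm i j * tperm i k)%g.
  by rewrite -!mulgA (tpermC j k) tC.
have e4 : (u * tperm j k * tperm i j = u * tperm i j * tperm i k)%g.
  by rewrite -!mulgA (tpermC i j) (tC j i k) // (tpermC j i).
rewrite e1 e2 e3 e4.
have -> : (u * tperm i j * tperm i k * tperm j k = u * tperm i k)%g.
  by rewrite -e3 -mulgA tperm2 mulg1.
have -> : (u * tperm i j * tperm j k * tperm i j = u * tperm i k)%g.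
  by rewrite -e2 -mulgA tperm2 mulg1.
have neq (x y : 'I_n) : x != y -> (u^-1 x != u^-1 y :> nat)%g.
  by rewrite val_eqE (inj_eq perm_inj).
move: (neq _ _ ij) (neq _ _ ik) (neq _ _ jk).
case: (ltngtP (u^-1 i)%g (u^-1 j)%g) => // xy _;
case: (ltngtP (u^-1 i)%g (u^-1 k)%g) => // xz _;
case: (ltngtP (u^-1 j)%g (u^-1 k)%g) => // yz _; try lia; ring.
Qed.


Definition avoids (a b : 'I_n) p :=
  [&& p.1 != a, p.1 != b, p.2 != a & p.2 != b].

Lemma edge_op_word_op_avoid c a b W f : all (avoids a b) W ->
  edge_op c (a, b) (word_op c W f) = word_op c W (edge_op c (a, b) f).
Proof.
elim: W => //= q W IH /andP[/and4P[h1 h2 h3 h4] /IH <-].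
by rewrite edge_op_comm //= eq_sym.
Qed.

Lemma shift_word_op_avoid c a b W f : all (avoids a b) W ->
  shift (swap (a, b)) (word_op c W f) = word_op c W (shift (swap (a, b)) f).
Proof.
elim: W => //= q W IH /andP[/and4P[h1 h2 h3 h4] /IH <-].
by rewrite shift_edge_op /swap /= tpermV !tpermD 1?eq_sym -?surjective_pairing.
Qed.

Definition star (A : seq 'I_n) (j : 'I_n) := [seq (i, j) | i <- A].

Lemma shift_star c s A j f : 
  shift s (word_op c (star A j) f) =
  word_op c (star [seq s^-1 i | i <- A] (s^-1 j))%g (shift s f).
Proof. by elim: A => //= i A IH; rewrite shift_edge_op IH. Qed.

Lemma avoids_star a b A j : j != a -> j != b -> a \notin A -> b \notin A ->
  all (avoids a b) (star A j).
Proof.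
move=> ja jb aA bA; rewrite all_map; apply/allP=> i iA; apply/and4P.
by split=> //=; [apply: contraNneq aA | apply: contraNneq bA] => <-.
Qed.

(** For distinct elements of [A] the factors are disjoint and commute, so they can be grouped into
    pairs [(k, j)], [(k, i)]; [(i, j)] passes each group by one braid relation. *)
Lemma braid_stars c i j A f : uniq A -> i != j -> i \notin A -> j \notin A ->
  edge_op c (i, j) (word_op c (star A j) (word_op c (star A i) f)) =
  word_op c (star A i) (word_op c (star A j) (edge_op c (i, j) f)).
Proof.
move=> + ij; elim: A => //= k A IH /andP[kA uA].
rewrite !in_cons !negb_or => /andP[ik iA] /andP[jk jA].
have [ki kj ji] : [/\ k != i, k != j & j != i] by split; rewrite eq_sym.
rewrite -(@edge_op_word_op_avoid c k i) ?avoids_star //.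
rewrite -(@edge_op_word_op_avoid c k j (star A i)) ?avoids_star //.
by rewrite -IH // -edge_op_braid.
Qed.
End Operators.

(** * The column word and its commutation with adjacent transpositions *)

Lemma adjacent_neq n (p : 'I_n * 'I_n) : p.2 = p.1.+1 :> nat -> p.1 != p.2.
Proof. by move=> p12; apply/eqP => e; move: p12; rewrite e => /n_Sn. Qed.

Definition below n (j : 'I_n) := [seq i : 'I_n <- enum 'I_n | (i < j)%N].

Definition revlex_pairs n : seq ('I_n * 'I_n) :=
  flatten [seq star (below j) j | j <- enum 'I_n].

Lemma enum_ord_adjacent n (i j : 'I_n) : j = i.+1 :> nat ->
  exists A C, [/\ enum 'I_n = A ++ [:: i, j & C],
    all (fun k : 'I_n => (k < i)%N) A & all (fun k : 'I_n => (j < k)%N) C].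
Proof.
move=> ij; exists (take i (enum 'I_n)), (drop j.+1 (enum 'I_n)).
have szE : size (enum 'I_n) = n by rewrite size_enum_ord.
have nthE (k : nat) (x0 : 'I_n) : (k < n)%N -> nth x0 (enum 'I_n) k = k :> nat.
  by move=> kn; rewrite -(nth_map _ 0%N) ?szE // val_enum_ord nth_iota.
split.
- rewrite -[LHS](cat_take_drop i) (drop_nth i) ?szE // -ij (drop_nth i) ?szE //.
  congr (_ ++ _ :: _ :: _); apply: val_inj; rewrite /= nthE //.
- apply/(all_nthP i) => k; rewrite size_take szE ltn_ord => ki.
  by rewrite nth_take // nthE // (ltn_trans ki).
apply/(all_nthP i) => k; rewrite size_drop szE => ki.
by rewrite nth_drop nthE; lia.
Qed.

Section Twist.
Variables (R : comNzRingType) (n : nat).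
Implicit Types (c : R) (f g : {ffun 'S_n -> R}) (p q : 'I_n * 'I_n).
Implicit Types (W : seq ('I_n * 'I_n)) (u v s : 'S_n).

(** Writing E for the edge operator and s for the shift, this is E s W = W s E. On [delta v] it
    becomes the recursion of R~, and its form is stable under inversion. *)
Definition twisted c W := forall p f, p.2 = p.1.+1 :> nat ->
  edge_op c p (shift (swap p) (word_op c W f)) =
  word_op c W (shift (swap p) (edge_op c p f)).

(** Columns k < i avoid i and j and commute with E and s. In a column k > j the entries (i, k), (j,
    k) are consecutive: the braid relation reverses them and s restores their order. In columns i
    and j, s exchanges the two stars and [braid_stars] puts them back; the leading E takes the place
    of the entry (i, j), which moves behind s, so that E s turns into s E. *)
Lemma twisted_revlex c : twisted c (revlex_pairs n).
Proof.
move=> [i j] f /= ij; have [A [C [eAC ltA gtC]]] := enum_ord_adjacent ij.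
have lt_ij : (i < j)%N by rewrite ij.
have i_j : i != j by rewrite -val_eqE neq_ltn lt_ij.
have belowE (k : 'I_n) : below k = [seq l : 'I_n <- A | (l < k)%N] ++
    [seq l : 'I_n <- [:: i; j] | (l < k)%N] ++ [seq l : 'I_n <- C | (l < k)%N].
  by rewrite /below eAC -filter_cat -filter_cat.
have uA : uniq A.
  by have := enum_uniq 'I_n; rewrite eAC cat_uniq => /andP[].
have iA : i \notin A by apply/negP => /(allP ltA); rewrite ltnn.
have jA : j \notin A by apply/negP => /(allP ltA); rewrite ltnNge ltnW.
have C0 (k : 'I_n) : (k <= j)%N -> [seq l : 'I_n <- C | (l < k)%N] = [::].
  move=> kj; apply/eqP; rewrite -(negbK (_ == _)) -has_filter; apply/hasPn => l /(allP gtC) jl.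
  by rewrite -leqNgt (leq_trans kj) // ltnW.
have filtA (k : 'I_n) : (i <= k)%N -> [seq l : 'I_n <- A | (l < k)%N] = A.
  move=> ik; apply/all_filterP/allP => l /(allP ltA) li; exact: leq_trans li ik.
have belowi : below i = A.
  by rewrite belowE (filtA i (leqnn i)) (C0 i (ltnW lt_ij)) /= ltnn ltnNge (ltnW lt_ij) /= cats0.
have belowj : below j = rcons A i.
  by rewrite belowE (filtA j (ltnW lt_ij)) (C0 j (leqnn j)) /= lt_ij ltnn /= cats1.
have low (k : 'I_n) : (k < i)%N -> all (avoids i j) (star (below k) k).
  move=> ki; apply: avoids_star; rewrite -?val_eqE ?neq_ltn ?ki ?(ltn_trans ki) //.
    by rewrite mem_filter ltnNge ltnW.
  by rewrite mem_filter ltnNge ltnW // (ltn_trans ki).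
have high (k : 'I_n) g : (j < k)%N ->
   shift (swap (i, j)) (edge_op c (i, j) (word_op c (star (below k) k) g)) =
   word_op c (star (below k) k) (shift (swap (i, j)) (edge_op c (i, j) g)).
  move=> jk; have ik := ltn_trans lt_ij jk.
  rewrite belowE (filtA k (ltnW ik)) /= ik jk /star !map_cat !word_op_cat -/(star _ _) /=.
  set C' := filter _ C.
  have av B : i \notin B -> j \notin B -> all (avoids i j) (star B k).
    by move=> iB jB; apply: avoids_star; rewrite -?val_eqE ?neq_ltn ?ik ?jk ?orbT.
  have iC' : i \notin C'.
    rewrite mem_filter negb_and; apply/orP; right; apply/negP => /(allP gtC).
    by rewrite ltnNge ltnW.
  have jC' : j \notin C'.
    by rewrite mem_filter negb_and; apply/orP; right; apply/negP => /(allP gtC); rewrite ltnn.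
  rewrite edge_op_word_op_avoid ?av // shift_word_op_avoid ?av //.
  rewrite edge_op_braid //; last 2 first.
  - by rewrite -val_eqE neq_ltn ik.
  - by rewrite -val_eqE neq_ltn jk.
  rewrite (@edge_op_word_op_avoid _ _ c i j (star C' k)) ?av // 2!shift_edge_op /=.
  rewrite shift_word_op_avoid ?av // /swap /= tpermV tpermL tpermR tpermD //.
    by rewrite -val_eqE neq_ltn ik.
  by rewrite -val_eqE neq_ltn jk.
have lows B g : all (fun k : 'I_n => (k < i)%N) B ->
   let V := flatten [seq star (below k) k | k <- B] in
   edge_op c (i, j) (shift (swap (i, j)) (word_op c V g)) =
   word_op c V (edge_op c (i, j) (shift (swap (i, j)) g)).
  elim: B => //= k B IH /andP[ki /IH{}IH].
  by rewrite !word_op_cat shift_word_op_avoid ?edge_op_word_op_avoid ?IH ?low.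
have highs B g : all (fun k : 'I_n => (j < k)%N) B ->
   let V := flatten [seq star (below k) k | k <- B] in
   shift (swap (i, j)) (edge_op c (i, j) (word_op c V g)) =
   word_op c V (shift (swap (i, j)) (edge_op c (i, j) g)).
  elim: B => //= k B IH /andP[ki /IH{}IH].
  by rewrite !word_op_cat high // IH.
have mid g : let V := star (below i) i ++ star (below j) j in
   edge_op c (i, j) (shift (swap (i, j)) (word_op c V g)) =
   word_op c V (shift (swap (i, j)) (edge_op c (i, j) g)).
  rewrite belowi belowj /star map_rcons -/(star _ _) -cats1 /= !word_op_cat /=.
  rewrite !shift_star /swap /= tpermV tpermL tpermR.
  have -> : [seq tperm i j l | l <- A] = A.
    rewrite -[RHS]map_id; apply/eq_in_map => l lA /=; rewrite tpermD //.
      by apply: contraNneq iA => ->.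
    by apply: contraNneq jA => ->.
  by rewrite braid_stars.
have WE g : word_op c (revlex_pairs n) g =
    word_op c (flatten [seq star (below k) k | k <- A])
      (word_op c (star (below i) i ++ star (below j) j)
        (word_op c (flatten [seq star (below k) k | k <- C]) g)).
  by rewrite /revlex_pairs eAC map_cat flatten_cat /= catA !word_op_cat.
by rewrite !WE lows // mid highs.
Qed.

(** At most one of [u] and [u * swap p] is rising, so [edge_op] minus the identity squares to
    zero. *)
Lemma edge_opK c p : p.1 != p.2 -> cancel (edge_op c p) (edge_op (- c) p).
Proof.
move=> p12 f; apply/ffunP=> u; rewrite !ffunE rising_swap // swapK.
by case: (rising u p) => /=; rewrite ?addr0 ?mulNr ?addrK.
Qed.

Lemma word_op_revK c W : all (fun p => p.1 != p.2) W ->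
  cancel (word_op c W) (word_op (- c) (rev W)).
Proof.
move=> ne f; elim: W ne => //= p W IH /andP[p12 /IH{}IH].
by rewrite rev_cons -cats1 word_op_cat /= edge_opK.
Qed.

(** Invert both sides of the relation for [- c]. *)
Lemma twisted_rev c W : all (fun p => p.1 != p.2) W ->
  twisted (- c) W -> twisted c (rev W).
Proof.
move=> ne tw p f p12.
have p_ne := adjacent_neq p12.
have neR : all (fun p => p.1 != p.2) (rev W) by rewrite all_rev.
have WK := word_op_revK (- c) ne; rewrite opprK in WK.
have RK := word_op_revK c neR; rewrite revK in RK.
have PK := edge_opK (- c) p_ne; rewrite opprK in PK.
have QK := edge_opK c p_ne.
have := tw p (edge_op c p (shift (swap p) (word_op c (rev W) f))) p12.
rewrite QK shiftK RK => def_f.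
by rewrite -[LHS]WK; congr (word_op c (rev W) _); rewrite -[in RHS]def_f PK shiftK.
Qed.
End Twist.

(** * Bruhat order and the polynomials R~ *)

Lemma bruhat_refl n (u : 'S_n) : bruhat u u.
Proof. exact: connect0. Qed.

Lemma bruhat_trans n (u v w : 'S_n) : bruhat u v -> bruhat v w -> bruhat u w.
Proof. exact: connect_trans. Qed.

Lemma bruhat_edge n (u v : 'S_n) : refl_lt u v -> bruhat u v.
Proof. exact: connect1. Qed.

Lemma bruhat_length n (u v : 'S_n) : bruhat u v -> u != v -> (length u < length v)%N.
Proof.
case/connectP=> p; elim: p u => [|w p IH] u /=; first by move=> _ ->; rewrite eqxx.
case/andP=> /andP[_ uw] wp lastp _; apply: leq_trans uw _.
by have [->//|wv] := eqVneq w v; apply/ltnW/IH.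
Qed.

Lemma bruhat_length_leq n (u v : 'S_n) : bruhat u v -> (length u <= length v)%N.
Proof. by move=> uv; have [->//|/(bruhat_length uv)/ltnW] := eqVneq u v. Qed.

Lemma bruhat_anti n (u v : 'S_n) : bruhat u v -> bruhat v u -> u = v.
Proof.
move=> uv vu; apply/eqP/idPn => ne; have := bruhat_length uv ne.
by rewrite ltnNge bruhat_length_leq.
Qed.

Lemma bruhat1 n (u : 'S_n) : bruhat u 1 = (u == 1).
Proof.
have [->|ne] := eqVneq u 1; first exact: bruhat_refl.
by apply/negP => /bruhat_length/(_ ne); rewrite length1.
Qed.

Lemma swap_adjacent_lt n (p q : 'I_n * 'I_n) :
  p.2 = p.1.+1 :> nat -> (q.1 < q.2)%N -> q != p ->
  (swap p q.1 < swap p q.2)%N.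
Proof.
by case: p q => i j [a b] /= ij ab ne; rewrite /swap /=; apply: tperm_adjacent_lt.
Qed.

Lemma refl_lt_mul_simple n (u v : 'S_n) (p : 'I_n * 'I_n) :
  p.2 = p.1.+1 :> nat -> refl_lt u v -> v != u * swap p ->
  refl_lt (u * swap p) (v * swap p).
Proof.
move=> p12 /refl_ltP[q [q12 up ->]] ne.
have qp : q != p by apply: contraNneq ne => ->.
apply/refl_ltP; exists (swap p q.1, swap p q.2); split=> /=.
- exact: swap_adjacent_lt.
- by rewrite /rising /= !pos_swap /swap !tpermK.
by rewrite -!mulgA; congr (_ * _); rewrite /swap -tpermJ -conjgC.
Qed.

Definition lower n (p : 'I_n * 'I_n) (u : 'S_n) := if rising u p then u else u * swap p.

(** A form of the lifting property. Along a chain, an edge survives multiplication by the adjacent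
    swap unless it is that swap, and then its two ends have the same lower element. *)
Lemma bruhat_lower n (p : 'I_n * 'I_n) (u v : 'S_n) :
  p.2 = p.1.+1 :> nat -> bruhat u v -> bruhat (lower p u) (lower p v).
Proof.
move=> p12; case/connectP=> w; elim: w u => [|x w IH] u /=.
  by move=> _ ->; apply: bruhat_refl.
case/andP=> ux xw lastw; apply: bruhat_trans (IH x xw lastw).
have lt12 : (p.1 < p.2)%N by rewrite p12.
have p_ne := adjacent_neq p12.
rewrite /lower; have [xE|ne] := eqVneq x (u * swap p).
  by rewrite xE rising_swap // swapK; case: ifP => _; apply: bruhat_refl.
have uxs := refl_lt_mul_simple p12 ux ne.
case: ifPn => [u_up|u_dn]; case: ifPn => [x_up|x_dn]; try exact: bruhat_edge.
  by apply: bruhat_trans (bruhat_edge uxs); apply: bruhat_edge; rewrite refl_lt_swap.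
apply: bruhat_trans (bruhat_edge ux); apply: bruhat_edge.
by rewrite -{2}(swapK u p) refl_lt_swap // rising_swap.
Qed.

Local Open Scope ring_scope.

Section Recursion.
Variables (R : comNzRingType) (n : nat).
Implicit Types (F : 'S_n -> 'S_n -> R).

(** The coefficients (1, x) give R~ and (q, q - 1) give R, so one uniqueness argument serves
    both. *)
Definition descent_recursion (a b : R) F := forall u v (p : 'I_n * 'I_n),
  p.2 = p.1.+1 :> nat -> ~~ rising v p ->
  F u v = if rising u p then a * F (u * swap p)%g (v * swap p)%g + b * F u (v * swap p)%g
          else F (u * swap p)%g (v * swap p)%g.

Lemma descent_recursion_unique a b F G :
  descent_recursion a b F -> descent_recursion a b G ->
  (forall u, F u 1%g = G u 1%g) -> forall u v, F u v = G u v.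
Proof.
move=> recF recG FG1 u v; have [k] := ubnP (length v).
elim: k u v => // k IH u v lt_vk.
have [->//|/exists_adjacent_drop[p p12 dn]] := eqVneq v 1%g.
have lt_vs : (length (v * swap p) < k)%N.
  by have := length_adjacent v p12; rewrite (negbTE dn) => vE; rewrite vE in lt_vk.
by rewrite (recF u v p) // (recG u v p) // !IH.
Qed.
End Recursion.

Section WordPoly.
Variables (R : comNzRingType) (n : nat).
Implicit Types (c : R) (f g : {ffun 'S_n -> R}) (p q : 'I_n * 'I_n).
Implicit Types (W : seq ('I_n * 'I_n)) (u v : 'S_n).

Definition word_poly c W u v := word_op c W (delta R v) u.

Definition increasing_pairs W := all (fun p : 'I_n * 'I_n => p.1 < p.2)%N W.

Lemma word_poly_cons c p W u v : word_poly c (p :: W) u v =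
  word_poly c W u v + (if rising u p then c * word_poly c W (u * swap p)%g v else 0).
Proof. by rewrite /word_poly /= ffunE. Qed.

Lemma word_poly_eq0 c W u v :
  increasing_pairs W -> ~~ bruhat u v -> word_poly c W u v = 0.
Proof.
elim: W u => [|p W IH] u /=.
  rewrite /word_poly /= ffunE; case: eqP => // -> _; by rewrite bruhat_refl.
case/andP=> p12 /IH{}IH nuv; rewrite word_poly_cons IH // add0r.
case: ifP => // up; rewrite IH ?mulr0 //; apply: contra nuv.
by apply: bruhat_trans; apply: bruhat_edge; rewrite refl_lt_swap.
Qed.

Lemma word_poly_diag c W u : increasing_pairs W -> word_poly c W u u = 1.
Proof.
elim: W => [|p W IH] /=; first by rewrite /word_poly /= ffunE eqxx.
case/andP=> p12 ltW; rewrite word_poly_cons IH //.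
case: ifP => [up|_]; last by rewrite addr0.
rewrite word_poly_eq0 ?mulr0 ?addr0 //; apply/negP => /bruhat_length_leq.
by rewrite leqNgt length_swap_up.
Qed.

Lemma word_op_axpy c W f g (a : R) u :
  word_op c W [ffun y => f y + a * g y] u = word_op c W f u + a * word_op c W g u.
Proof.
elim: W u => [|p W IH] u; first by rewrite /= ffunE.
by rewrite /= !ffunE !IH; case: ifP => _; ring.
Qed.

Lemma word_op0 c W u : word_op c W [ffun=> 0] u = 0.
Proof. by elim: W u => [|p W IH] u /=; rewrite ffunE // !IH mulr0 if_same addr0. Qed.

Lemma word_op_sum c W f u : word_op c W f u = \sum_v f v * word_poly c W u v.
Proof.
have fE : f = [ffun y => \sum_(v <- enum 'S_n) f v * delta R v y].
  apply/ffunP=> y; rewrite ffunE big_enum /= (bigD1 y) //= ffunE eqxx mulr1.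
  by rewrite big1 ?addr0 // => v /negbTE vy; rewrite ffunE eq_sym vy mulr0.
rewrite -big_enum {1}fE /=; elim: (enum _) => [|v s IH].
  by rewrite big_nil -[RHS](word_op0 c W u); congr (word_op c W _ u); apply/ffunP=> y;
    rewrite !ffunE big_nil.
rewrite big_cons -IH addrC -word_op_axpy; congr (word_op c W _ u).
by apply/ffunP=> y; rewrite [LHS]ffunE [RHS]ffunE big_cons addrC [X in _ = X + _]ffunE.
Qed.

(** When [v] falls at [p], s E sends [delta v] to [delta (v * swap p) + c delta v]. The twisting
    relation is read at [u * swap p] and, if [u] rises, also at [u]. *)
Lemma word_poly_recursion c W :
  twisted c W -> descent_recursion 1 c (word_poly c W).
Proof.
move=> tw u v p p12 dn; have p_ne := adjacent_neq p12.
have key x : word_poly c W (x * swap p)%g v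
      + (if rising x p then c * word_poly c W x v else 0)
    = word_poly c W x (v * swap p)%g + c * word_poly c W x v.
  have := tw p (delta R v) p12; move/ffunP/(_ x).
  rewrite !ffunE swapK.
  have -> : shift (swap p) (edge_op c p (delta R v))
      = [ffun y => delta R (v * swap p)%g y + c * delta R v y].
    apply/ffunP=> y; rewrite !ffunE swapK.
    rewrite -(inj_eq (mulIg (swap p)) (y * _)%g) swapK; congr (_ + _).
    have [->|] := eqVneq y v; first by rewrite rising_swap // dn.
    by rewrite mulr0 if_same.
  by rewrite word_op_axpy.
case: ifPn => [up|u_dn].
  have := key (u * swap p)%g; rewrite swapK rising_swap // up /= addr0 => ->.
  by rewrite mul1r; congr (_ + _ * _); have := key u; rewrite up => /addIr.
by have := key (u * swap p)%g; rewrite swapK rising_swap // u_dn => /addIr.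
Qed.

(** Both words satisfy the same recursion, with the same values at the identity. *)
Lemma word_poly_rev c W :
  increasing_pairs W -> twisted c W -> twisted (- c) W ->
  forall u v, word_poly c (rev W) u v = word_poly c W u v.
Proof.
move=> ltW tw twN.
have neW : all (fun p => p.1 != p.2) W.
  by apply: sub_all ltW => p; rewrite -val_eqE neq_ltn => ->.
have ltR : increasing_pairs (rev W) by rewrite /increasing_pairs all_rev.
apply: (@descent_recursion_unique _ _ 1 c).
- by apply: word_poly_recursion; apply: twisted_rev.
- exact: word_poly_recursion.
move=> u; have [->|ne] := eqVneq u 1%g; first by rewrite !word_poly_diag.
by rewrite !word_poly_eq0 // bruhat1.
Qed.

(** The operator of [rev W] at [c] is inverted by that of [W] at [- c], and reversing the word does
    not change its entries. *)
Lemma word_poly_inverse c W :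
  increasing_pairs W -> twisted c W -> twisted (- c) W ->
  forall u v, \sum_a word_poly (- c) W u a * word_poly c W a v = (u == v)%:R.
Proof.
move=> ltW tw twN u v.
have neR : all (fun p => p.1 != p.2) (rev W).
  by rewrite all_rev; apply: sub_all ltW => p; rewrite -val_eqE neq_ltn => ->.
have /ffunP/(_ u) := word_op_revK c neR (delta R v).
rewrite revK ffunE word_op_sum => <-; apply: eq_bigr => a _.
by rewrite mulrC -(word_poly_rev ltW tw twN).
Qed.
End WordPoly.

Lemma increasing_revlex n : increasing_pairs (revlex_pairs n).
Proof.
rewrite /increasing_pairs /revlex_pairs; elim: (enum _) => //= j s IH.
rewrite all_cat IH andbT all_map; apply/allP=> i /=.
by rewrite mem_filter => /andP[].
Qed.

Lemma map_word_poly (R S : comNzRingType) (h : {rmorphism R -> S}) n c W (u v : 'S_n) :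
  h (word_poly c W u v) = word_poly (h c) W u v.
Proof.
elim: W u => [|p W IH] u; first by rewrite /word_poly /= !ffunE rmorph_nat.
by rewrite !word_poly_cons rmorphD IH; case: ifP => _; rewrite ?rmorphM ?IH ?rmorph0.
Qed.

Definition Rtilde n (u v : 'S_n) : {poly int} := word_poly 'X (revlex_pairs n) u v.

Lemma Rtilde_eq0 n (u v : 'S_n) : ~~ bruhat u v -> Rtilde u v = 0.
Proof. by apply: word_poly_eq0; apply: increasing_revlex. Qed.

Lemma Rtilde_diag n (u : 'S_n) : Rtilde u u = 1.
Proof. by apply: word_poly_diag; apply: increasing_revlex. Qed.

Lemma Rtilde_recursion n : descent_recursion 1 'X (@Rtilde n).
Proof. by apply: word_poly_recursion; apply: twisted_revlex. Qed.

Lemma Rtilde_inverse n (u v : 'S_n) :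
  \sum_a (Rtilde u a \Po (- 'X)) * Rtilde a v = (u == v)%:R.
Proof.
rewrite -(word_poly_inverse (c := 'X) (increasing_revlex n)); try exact: twisted_revlex.
apply: eq_bigr => a _; congr (_ * _).
by rewrite -[_ \Po _]/(comp_poly _ _) map_word_poly /= comp_polyX.
Qed.

Definition homogeneous_parity d (p : {poly int}) :=
  forall k, p`_k != 0 -> (k <= d)%N && ~~ odd (d - k).

Lemma size_homogeneous d (p : {poly int}) :
  homogeneous_parity d p -> (size p <= d.+1)%N.
Proof.
move=> hp; apply/leq_sizeP => k dk; apply/eqP/idPn => /hp.
by rewrite leqNgt dk.
Qed.

(** Every edge raises the length by an odd amount. The parity makes the halved exponents in
    [dehomogenize] exact. *)
Lemma Rtilde_homogeneous n (u v : 'S_n) :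
  homogeneous_parity (length v - length u) (Rtilde u v).
Proof.
rewrite /Rtilde; elim: (revlex_pairs n) (increasing_revlex n) u => [|p W IH] /=.
  move=> _ u k; rewrite /word_poly /= ffunE.
  have [->|_] := eqVneq u v; last by rewrite coef0 eqxx.
  by rewrite coef1 subnn; case: k.
case/andP=> p12 ltW u k; have {}IH := IH ltW; rewrite word_poly_cons coefD.
have [->|nz _] := eqVneq ((word_poly 'X W u v : {poly int})`_k) 0; last exact: IH nz.
rewrite add0r; case: ifP => up; last by rewrite coef0 eqxx.
rewrite coefXM; case: k => [|k]; first by rewrite eqxx.
(* A nonzero coefficient forces the Bruhat relation, so the truncated difference of lengths is the
   true one. *)
move=> /= nz; have uv : bruhat (u * swap p)%g v.
  by apply: contraNT nz => /(word_poly_eq0 'X ltW) ->; rewrite coef0.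
have := IH _ _ nz; have := bruhat_length_leq uv; have := length_swap_up p12 up.
have : odd (length (u * swap p)%g) = ~~ odd (length u).
  rewrite !odd_length odd_permM odd_tperm -val_eqE neq_ltn p12 addbT //.
by lia.
Qed.

(** In the recursion the term x R~(u, v s) reaches the full degree and the other has smaller degree;
    [bruhat_lower] provides the comparison needed for the induction. *)
Lemma size_Rtilde n (u v : 'S_n) :
  bruhat u v -> size (Rtilde u v) = (length v - length u).+1.
Proof.
have [k] := ubnP (length v); elim: k u v => // k IH u v lt_vk uv.
have [vE|/exists_adjacent_drop[p p12 dn]] := eqVneq v 1%g.
  by move: uv; rewrite vE bruhat1 => /eqP ->; rewrite Rtilde_diag subnn size_poly1.
have vE : length v = (length (v * swap p)%g).+1.
  by have := length_adjacent v p12; rewrite (negbTE dn).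
have lt_vs : (length (v * swap p)%g < k)%N by rewrite vE in lt_vk.
have := bruhat_lower p12 uv; rewrite /lower (negbTE dn) (Rtilde_recursion u p12 dn).
have := length_adjacent u p12; case: ifP => up uE u_vs; last first.
  by rewrite IH // vE [in RHS]uE subSS.
have szX : size ('X * Rtilde u (v * swap p)%g) = (length v - length u).+1.
  rewrite mulrC size_mulX ?IH // ?vE ?subSn ?bruhat_length_leq //.
  by rewrite -size_poly_eq0 IH.
rewrite mul1r addrC size_polyDl ?szX //.
have := size_homogeneous (@Rtilde_homogeneous _ (u * swap p)%g (v * swap p)%g).
by have := bruhat_length_leq u_vs; rewrite uE vE; lia.
Qed.

Lemma Rtilde_neq0 n (u v : 'S_n) : (Rtilde u v != 0) = bruhat u v.
Proof.
apply/idP/idP => [|uv]; first by apply: contraNT => /Rtilde_eq0 ->.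
by rewrite -size_poly_eq0 size_Rtilde.
Qed.

(** * From R~ to R *)

Section Expand.
Implicit Types (p r : {poly int}) (m : nat -> {poly int}) (d : nat).

(** A common form of [reversal] and [dehomogenize], so that multiplicativity is proved once. *)
Definition expand m d p : {poly int} := \sum_(k < d.+1) p`_k *: m k.

Lemma expandD m d p r : expand m d (p + r) = expand m d p + expand m d r.
Proof. by rewrite -big_split; apply: eq_bigr => k _; rewrite coefD scalerDl. Qed.

Lemma expandZ m d (a : int) p : expand m d (a *: p) = a *: expand m d p.
Proof. by rewrite scaler_sumr; apply: eq_bigr => k _; rewrite coefZ scalerA. Qed.

Lemma expand0 m d : expand m d 0 = 0.
Proof. by apply: big1 => k _; rewrite coef0 scale0r. Qed.

Lemma expand_sum m d (I : Type) (s : seq I) (P : pred I) (F : I -> {poly int}) :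
  expand m d (\sum_(i <- s | P i) F i) = \sum_(i <- s | P i) expand m d (F i).
Proof. exact: (big_morph _ (expandD m d) (expand0 m d)). Qed.

Lemma expandXn m d j : (j <= d)%N -> expand m d 'X^j = m j.
Proof.
move=> jd; have jd1 : (j < d.+1)%N by [].
rewrite /expand (bigD1 (Ordinal jd1)) //= coefXn eqxx scale1r big1 ?addr0 // => k kj.
by rewrite coefXn -val_eqE /= in kj *; rewrite (negbTE kj) scale0r.
Qed.

(** The product rule is asked only at nonzero coefficients, because the halved exponents of
    [dehomogenize] add up only for indices of the right parity. *)
Lemma expandM m1 m2 m3 d1 d2 p r :
  (size p <= d1.+1)%N -> (size r <= d2.+1)%N ->
  (forall k l, p`_k != 0 -> r`_l != 0 -> m1 k * m2 l = m3 (k + l)%N) ->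
  expand m1 d1 p * expand m2 d2 r = expand m3 (d1 + d2) (p * r).
Proof.
move=> szp szr m12.
have defp N (q : {poly int}) : (size q <= N)%N -> q = \sum_(k < N) q`_k *: 'X^k.
  by move=> szq; rewrite -poly_def; apply/polyP=> i; rewrite coef_poly;
     case: ltnP => // Ni; rewrite nth_default // (leq_trans szq).
rewrite [in RHS](defp _ _ szp) [in RHS](defp _ _ szr) [in RHS]mulr_suml expand_sum.
rewrite [in LHS]/expand mulr_suml.
apply: eq_bigr => k _; rewrite [in RHS]mulr_sumr expand_sum mulr_sumr; apply: eq_bigr => l _.
rewrite -!scalerAl -!scalerAr !expandZ -exprD expandXn; last first.
  by rewrite leq_add // -ltnS.
have [->|pk] := eqVneq p`_k 0; first by rewrite !scale0r.
have [->|rl] := eqVneq r`_l 0; first by rewrite !scale0r !scaler0.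
by rewrite m12.
Qed.

Lemma coef_neq0_lt p k : p`_k != 0 -> (k < size p)%N.
Proof. by apply: contraNT; rewrite -leqNgt => /(nth_default 0) ->. Qed.

Lemma reversal_expand d p : reversal d p = expand (fun k => 'X^(d - k)) d p.
Proof.
rewrite /reversal poly_def (reindex_inj rev_ord_inj); apply: eq_bigr => k _ /=.
by rewrite !subSS subKn // -ltnS.
Qed.

Lemma reversalM d1 d2 p r : (size p <= d1.+1)%N -> (size r <= d2.+1)%N ->
  reversal (d1 + d2) (p * r) = reversal d1 p * reversal d2 r.
Proof.
move=> szp szr; rewrite !reversal_expand; apply/esym/expandM => // k l pk rl.
rewrite -exprD; congr ('X^_).
have := leq_trans (coef_neq0_lt pk) szp; have := leq_trans (coef_neq0_lt rl) szr; lia.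
Qed.

(* [(q - 1)^k q^((d - k)/2)] is [q^(d/2) x^k] at [x = q^(1/2) - q^(-1/2)].   *)
Definition dehomogenize d := expand (fun k => ('X - 1) ^+ k * 'X^((d - k)./2)) d.

Lemma dehomogenizeM d1 d2 p r :
  homogeneous_parity d1 p -> homogeneous_parity d2 r ->
  dehomogenize d1 p * dehomogenize d2 r = dehomogenize (d1 + d2) (p * r).
Proof.
move=> hp hr; apply: expandM; try exact: size_homogeneous.
move=> k l /hp + /hr; move=> /andP[kd ok] /andP[ld ol].
rewrite mulrACA -!exprD; congr (_ * 'X^_); lia.
Qed.

Lemma reversal_sum d (I : Type) (s : seq I) (P : pred I) (F : I -> {poly int}) :
  reversal d (\sum_(i <- s | P i) F i) = \sum_(i <- s | P i) reversal d (F i).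
Proof. by rewrite reversal_expand expand_sum; apply: eq_bigr => i _; rewrite reversal_expand. Qed.

Lemma size_XsubC1_exp k : size (('X - 1 : {poly int}) ^+ k) = k.+1.
Proof. by rewrite -[1]/(1%:P) size_exp_XsubC. Qed.

Lemma reversal_XsubC1_exp k :
  reversal k (('X - 1) ^+ k) = (-1) ^+ k *: ('X - 1) ^+ k.
Proof.
elim: k => [|k IH].
  by rewrite !expr0 scale1r reversal_expand; exact: (@expandXn _ 0 0).
have rev1 : reversal 1 ('X - 1) = - ('X - 1).
  rewrite reversal_expand /expand !big_ord_recl big_ord0 /= !coefB !coefX !coef1 /=.
  by rewrite expr1 expr0 sub0r subr0 scaleN1r scale1r addr0 opprB addrC.
rewrite exprS -add1n reversalM ?size_XsubC1_exp //; last first.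
  by have := size_XsubC1_exp 1; rewrite expr1 => ->.
by rewrite rev1 IH add1n (exprS (-1)) -scalerA -scalerAr scaleN1r -scalerN mulNr.
Qed.

Lemma coef_comp_polyN p k : (p \Po - 'X)`_k = p`_k * (-1) ^+ k.
Proof.
rewrite coef_comp_poly; have NXn i : ((- 'X : {poly int}) ^+ i)`_k = (k == i)%:R * (-1) ^+ k.
  rewrite -scaleN1r exprZn coefZ coefXn mulrC.
  by case: eqP => [->//|_]; rewrite !mul0r.
case: (ltnP k (size p)) => [kp|pk].
  rewrite (bigD1 (Ordinal kp)) //= NXn eqxx mul1r big1 ?addr0 // => i ik.
  rewrite NXn eq_sym; rewrite -val_eqE /= in ik.
  by rewrite (negbTE ik) mul0r mulr0.
rewrite (nth_default 0 pk) mul0r big1 // => i _; rewrite NXn.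
by rewrite gtn_eqF ?mul0r ?mulr0 // (leq_trans _ pk).
Qed.

(** Replacing q by 1/q sends x = q^(1/2) - q^(-1/2) to -x. *)
Lemma reversal_dehomogenize d p : homogeneous_parity d p ->
  reversal d (dehomogenize d p) = dehomogenize d (p \Po - 'X).
Proof.
move=> hp; rewrite /dehomogenize {1}/expand reversal_sum; apply: eq_bigr => k _.
rewrite reversal_expand expandZ -reversal_expand.
rewrite coef_comp_polyN -scalerA.
have [->|/hp/andP[kd ev]] := eqVneq p`_k 0; first by rewrite !scale0r.
congr (_ *: _).
rewrite -[in reversal d](subnKC kd) reversalM ?size_XsubC1_exp //; last first.
  rewrite size_polyXn; lia.
have -> : reversal (d - k) 'X^((d - k)./2) = 'X^((d - k)./2).
  rewrite reversal_expand expandXn ?leq_half_double; [congr ('X^_)|]; lia.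
by rewrite reversal_XsubC1_exp scalerAl.
Qed.
End Expand.

Lemma dehomogenize_shift2 d p : homogeneous_parity d p ->
  dehomogenize d.+2 p = 'X * dehomogenize d p.
Proof.
move=> hp; have h1 : homogeneous_parity 2 1.
  by move=> k; rewrite coef1; case: k.
rewrite -[p in LHS]mul1r -(@dehomogenizeM 2) //.
by rewrite {1}/dehomogenize (@expandXn _ 2 0) // expr0 mul1r expr1.
Qed.

Lemma dehomogenizeXM d p : homogeneous_parity d p ->
  dehomogenize d.+1 ('X * p) = ('X - 1) * dehomogenize d p.
Proof.
move=> hp; have h1 : homogeneous_parity 1 'X.
  by move=> k; rewrite coefX; case: k => [|[|k]].
rewrite -(@dehomogenizeM 1) // {1}/dehomogenize -['X in LHS]expr1 expandXn //.
by rewrite expr0 expr1 mulr1.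
Qed.

Definition Rdehom n (u v : 'S_n) : {poly int} :=
  dehomogenize (length v - length u) (Rtilde u v).

Lemma Rdehom_eq0 n (u v : 'S_n) : ~~ bruhat u v -> Rdehom u v = 0.
Proof. by move=> nuv; rewrite /Rdehom Rtilde_eq0 // /dehomogenize expand0. Qed.

Lemma Rdehom_diag n (u : 'S_n) : Rdehom u u = 1.
Proof.
by rewrite /Rdehom Rtilde_diag subnn /dehomogenize (@expandXn _ 0 0) // !expr0 mulr1.
Qed.

Lemma Rdehom_recursion n : descent_recursion 'X ('X - 1) (@Rdehom n).
Proof.
move=> u v p p12 dn.
have vE : length v = (length (v * swap p)%g).+1.
  by have := length_adjacent v p12; rewrite (negbTE dn).
rewrite {1}/Rdehom (Rtilde_recursion u p12 dn).
have := length_adjacent u p12; case: ifP => up uE; last by rewrite uE vE subSS.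
rewrite mul1r /dehomogenize expandD -!/(dehomogenize _ _); congr (_ + _).
  have [us_vs|n_us_vs] := boolP (bruhat (u * swap p)%g (v * swap p)%g); last first.
    by rewrite Rdehom_eq0 // Rtilde_eq0 // mulr0 /dehomogenize expand0.
  rewrite /Rdehom -dehomogenize_shift2; last exact: Rtilde_homogeneous.
  by congr dehomogenize; have := bruhat_length_leq us_vs; rewrite uE vE; lia.
have [u_vs|n_u_vs] := boolP (bruhat u (v * swap p)%g); last first.
  by rewrite Rdehom_eq0 // Rtilde_eq0 // !mulr0 /dehomogenize expand0.
rewrite /Rdehom -dehomogenizeXM; last exact: Rtilde_homogeneous.
by congr dehomogenize; have := bruhat_length_leq u_vs; rewrite vE; lia.
Qed.

Lemma descent_swap n (v : 'S_n) (p : 'I_n * 'I_n) :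
  p.2 = p.1.+1 :> nat -> descent v (swap p) = ~~ rising v p.
Proof.
move=> p12; rewrite /descent; have -> : swap p \in simples n.
  by apply/simplesP; exists p.
by have := length_adjacent v p12; case: ifP => _ -> /=; rewrite ?ltnn ?ltnS ?leqnn // ltnNge leqW.
Qed.

Lemma R_family_Rdehom n : R_family (@Rdehom n).
Proof.
split; [exact: Rdehom_eq0 | exact: Rdehom_diag | move=> u v s vs].
have [/simplesP[p p12 sE] _] := andP vs; rewrite sE descent_swap // in vs *.
by rewrite (Rdehom_recursion u p12 vs) descent_swap //; case: (rising u p).
Qed.

(** [Rdehom] witnesses that an R-family exists, which gives the chosen [Rpoly] its defining
    conditions; the recursion then determines it. *)
Lemma Rpoly_dehom n (u v : 'S_n) : Rpoly u v = Rdehom u v.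
Proof.
have [R0 R1 Rrec] : R_family (@Rpoly n).
  by apply: epsilon_spec; exists (@Rdehom n); apply: R_family_Rdehom.
apply: (@descent_recursion_unique _ n 'X ('X - 1)) u v.
- move=> u v p p12 dn; rewrite (Rrec u v (swap p)) ?descent_swap //.
  by case: (rising u p).
- exact: Rdehom_recursion.
move=> u; have [->|ne] := eqVneq u 1%g; first by rewrite R1 Rdehom_diag.
by rewrite R0 ?Rdehom_eq0 // bruhat1.
Qed.

Lemma size_dehomogenize d p : homogeneous_parity d p -> (size (dehomogenize d p) <= d.+1)%N.
Proof.
move=> hp; apply: (leq_trans (size_sum _ _ _)); apply/bigmax_leqP => k _.
have [->|/hp/andP[kd ev]] := eqVneq p`_k 0; first by rewrite scale0r size_poly0.
apply: (leq_trans (size_scale_leq _ _)); apply: (leq_trans (size_polyMleq _ _)).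
by rewrite size_XsubC1_exp size_polyXn; lia.
Qed.

Lemma size_Rdehom n (u v : 'S_n) : (size (Rdehom u v) <= (length v - length u).+1)%N.
Proof. by apply: size_dehomogenize; apply: Rtilde_homogeneous. Qed.

Lemma homogeneous_comp_polyN d p : homogeneous_parity d p ->
  homogeneous_parity d (p \Po - 'X).
Proof.
by move=> hp k; rewrite coef_comp_polyN mulf_eq0 negb_or => /andP[/hp].
Qed.

Lemma Rdehom_inverse n (u v : 'S_n) :
  \sum_(a in interval u v) reversal (length a - length u) (Rdehom u a) * Rdehom a v
    = (u == v)%:R.
Proof.
have hRt (x y : 'S_n) := @Rtilde_homogeneous n x y.
transitivity (dehomogenize (length v - length u) (u == v)%:R); last first.
  have [->|_] := eqVneq u v; last by rewrite /dehomogenize expand0.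
  by rewrite subnn /dehomogenize (@expandXn _ 0 0) // !expr0 mulr1.
rewrite -Rtilde_inverse /dehomogenize expand_sum -/(dehomogenize _).
rewrite [RHS](bigID (mem (interval u v))) /= [X in _ = _ + X]big1 ?addr0.
  apply: eq_bigr => a; rewrite inE => /andP[ua av].
  rewrite /Rdehom reversal_dehomogenize // dehomogenizeM //; last exact: homogeneous_comp_polyN.
  congr (dehomogenize _ _).
  by have := bruhat_length_leq ua; have := bruhat_length_leq av; lia.
move=> a; rewrite inE negb_and => /orP[] nb.
  by rewrite (Rtilde_eq0 nb) comp_poly0 mul0r /dehomogenize expand0.
by rewrite (Rtilde_eq0 nb) mulr0 /dehomogenize expand0.
Qed.

(** * Kazhdan-Lusztig polynomials *)

Lemma coef_reversal d (p : {poly int}) i :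
  (reversal d p)`_i = if (i <= d)%N then p`_(d - i) else 0.
Proof. by rewrite coef_poly ltnS. Qed.

(** [uphalf d] keeps exactly the coefficients i with 2i < d. The middle coefficient, if there is
    one, equals its own negative and vanishes. *)
Lemma reversal_antisym_solve d (F : {poly int}) :
  (size F <= d.+1)%N -> reversal d F = - F ->
  let T := - take_poly (uphalf d) F in reversal d T = T + F.
Proof.
move=> szF antiF T; apply/polyP=> i; rewrite coef_reversal coefD !coefN !coef_take_poly.
case: (leqP i d) => [id|di]; last first.
  by rewrite (nth_default 0 (leq_trans szF di)) if_same oppr0 addr0.
have FE : F`_(d - i) = - F`_i by have /polyP/(_ i) := antiF; rewrite coef_reversal id coefN.
rewrite FE; have [i2d|ne] := eqVneq (i.*2) d.
  have F0 : F`_i = 0 by move: FE; rewrite -i2d -addnn addnK => FE; lia.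
  by rewrite F0 oppr0 !if_same oppr0 addr0.
have -> : (d - i < uphalf d)%N = ~~ (i < uphalf d)%N by lia.
by case: (i < uphalf d)%N; rewrite ?opprK ?oppr0 ?add0r ?addNr.
Qed.

(** Below d/2 the reversal of [T] has zero coefficients, so the equation reads T = -G there. *)
Lemma reversal_unique d (T T' G : {poly int}) :
  ((size T).-1.*2 < d)%N -> ((size T').-1.*2 < d)%N ->
  reversal d T = T + G -> reversal d T' = T' + G -> T = T'.
Proof.
move=> szT szT' eT eT'; apply/polyP=> i.
have small (p : {poly int}) j : ((size p).-1.*2 < d)%N -> (d <= j.*2)%N -> p`_j = 0.
  by move=> szp dj; rewrite nth_default //; move: szp dj; case: (size p) => [|s] /=; lia.
have [di|id] := leqP d i.*2; first by rewrite !small.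
have /polyP/(_ i) := eT; have /polyP/(_ i) := eT'.
rewrite !coef_reversal !coefD.
have -> : (i <= d)%N by lia.
have di2 : (d <= (d - i).*2)%N by lia.
by rewrite (small T _ szT di2) (small T' _ szT' di2) => e' e; apply: (addIr G`_i); rewrite -e -e'.
Qed.

Section Existence.
Variable n : nat.
Implicit Types u v a b : 'S_n.

(** The recursion raises [u] inside the interval; the default 0 for exhausted fuel is not reached
    once the fuel exceeds the length difference. *)
Fixpoint KLfuel k u v : {poly int} :=
  if k is k'.+1 then
    if u == v then 1 else
    if bruhat u v then
      - take_poly (uphalf (length v - length u))
          (\sum_(a in interval u v | a != u) Rdehom u a * KLfuel k' a v)
    else 0
  else 0.

Lemma interval_above u v a : a \in interval u v -> a != u ->
  (length u < length a)%N /\ (length a <= length v)%N.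
Proof.
rewrite inE => /andP[ua av] ne; split; last exact: bruhat_length_leq.
by apply: bruhat_length; rewrite // eq_sym.
Qed.

Lemma KLfuel_stable k k' u v :
  (length v - length u < k)%N -> (length v - length u < k')%N ->
  KLfuel k u v = KLfuel k' u v.
Proof.
elim: k k' u => [|k IH] [|k'] u //= lt_k lt_k'.
case: eqP => // _; case: ifP => // _; congr (- take_poly _ _).
apply: eq_bigr => a /andP[aI au].
have [ua av] := interval_above aI au.
by rewrite (IH k') //; lia.
Qed.

Definition KLrec u v := KLfuel (length v - length u).+1 u v.

Definition KLsum u v := \sum_(a in interval u v | a != u) Rdehom u a * KLrec a v.

Lemma KLrec_eq0 u v : ~~ bruhat u v -> KLrec u v = 0.
Proof.
move=> nuv; rewrite /KLrec /= (negbTE nuv); case: eqP => // uv.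
by rewrite uv bruhat_refl in nuv.
Qed.

Lemma KLrec_diag u : KLrec u u = 1.
Proof. by rewrite /KLrec /= eqxx. Qed.

Lemma KLrecE u v : bruhat u v -> u != v ->
  KLrec u v = - take_poly (uphalf (length v - length u)) (KLsum u v).
Proof.
move=> uv ne; rewrite {1}/KLrec /= (negbTE ne) uv; congr (- take_poly _ _).
apply: eq_bigr => a /andP[aI au].
have [ua av] := interval_above aI au.
by congr (_ * _); apply: KLfuel_stable; lia.
Qed.

Lemma size_KLrec u v : bruhat u v -> u != v ->
  ((size (KLrec u v)).-1.*2 < length v - length u)%N.
Proof.
move=> uv ne; rewrite KLrecE // size_polyN.
set d := (_ - _)%N; set p := take_poly _ _.
have d_gt0 : (0 < d)%N by rewrite subn_gt0 bruhat_length.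
have : (size p <= uphalf d)%N by apply: size_take_poly.
by move: (size p) => s; lia.
Qed.

Lemma size_KLrec_leq u v : (size (KLrec u v) <= (length v - length u).+1)%N.
Proof.
have [uv|nuv] := boolP (bruhat u v); last by rewrite KLrec_eq0 // size_poly0.
have [->|ne] := eqVneq u v; first by rewrite KLrec_diag size_poly1.
by have := size_KLrec uv ne; move: (size _) => s; lia.
Qed.

Lemma interval_sum_split u v (F : 'S_n -> {poly int}) : bruhat u v ->
  \sum_(a in interval u v) F a = F u + \sum_(a in interval u v | a != u) F a.
Proof. by move=> uv; rewrite (bigD1 u) //= inE bruhat_refl. Qed.

(** It suffices that [KLsum u v] is antisymmetric under reversal. Reversing it and expanding each
    reversed P(a, v) by induction gives a double sum over u < a <= b; by [Rdehom_inverse] the sum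
    over a equals -R(u, b), minus the missing term a = u. *)
Lemma reversal_KLrec u v : bruhat u v ->
  reversal (length v - length u) (KLrec u v)
    = \sum_(a in interval u v) Rdehom u a * KLrec a v.
Proof.
have [k] := ubnP (length v - length u)%N; elim: k u => // k IH u lt_k uv.
rewrite interval_sum_split // Rdehom_diag mul1r -/(KLsum u v).
have [uE|ne] := eqVneq u v.
  rewrite uE subnn KLrec_diag /KLsum big1 ?addr0.
    by rewrite reversal_expand; exact: (@expandXn _ 0 0).
  move=> a /andP[]; rewrite inE => /andP[va av].
  by rewrite (bruhat_anti va av) eqxx.
rewrite {1}KLrecE // [in RHS]KLrecE //; apply: reversal_antisym_solve.
  apply: (leq_trans (size_sum _ _ _)); apply/bigmax_leqP => a /andP[aI au].
  have [ua av] := interval_above aI au.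
  apply: (leq_trans (size_polyMleq _ _)).
  have := size_Rdehom u a; have := size_KLrec_leq a v.
  by move: (size _) (size _) => s t; lia.
rewrite /KLsum reversal_sum.
transitivity (\sum_(a in interval u v | a != u) \sum_(b in interval a v)
    reversal (length a - length u) (Rdehom u a) * Rdehom a b * KLrec b v).
  apply: eq_bigr => a /andP[aI au]; have [ua av] := interval_above aI au.
  have -> : (length v - length u = (length a - length u) + (length v - length a))%N by lia.
  rewrite reversalM ?size_Rdehom ?size_KLrec_leq // IH; last 2 first.
  - by lia.
  - by move: aI; rewrite inE => /andP[].
  by rewrite mulr_sumr; apply: eq_bigr => b _; rewrite mulrA.
rewrite (exchange_big_dep (fun b => (b \in interval u v) && (b != u))) /=; last first.
  move=> a b /andP[aI au]; rewrite !inE => /andP[ab ->].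
  move: aI; rewrite inE => /andP[ua _]; rewrite (bruhat_trans ua ab) /=.
  by apply: contraNneq au => bE; apply/eqP/bruhat_anti; rewrite // -bE.
rewrite -sumrN; apply: eq_bigr => b /andP[bI bu].
move: bI; rewrite inE => /andP[ub bv].
rewrite -mulNr -mulr_suml; congr (_ * _).
have := Rdehom_inverse u b; rewrite eq_sym (negbTE bu) interval_sum_split //.
rewrite subnn Rdehom_diag reversal_expand (@expandXn _ 0 0) // mul1r => /eqP.
rewrite addrC addr_eq0 => /eqP <-; apply: eq_bigl => a; rewrite !inE bv andbT.
apply/idP/idP => [/andP[/andP[/andP[ua av] ->] ab]|/andP[/andP[ua ab] ->]].
  by rewrite ua ab.
by rewrite ua ab (bruhat_trans ab bv).
Qed.

Lemma KL_family_KLpoly : KL_family (@KLpoly n).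
Proof.
apply: epsilon_spec; exists KLrec; split.
- exact: KLrec_eq0.
- exact: KLrec_diag.
- exact: size_KLrec.
move=> u v uv; rewrite reversal_KLrec //.
by apply: eq_bigr => a _; rewrite Rpoly_dehom.
Qed.
End Existence.

(** * Transport along a graph isomorphism *)

Definition revlex n (p q : 'I_n * 'I_n) : bool :=
  (p.2 < q.2)%N || (p.2 == q.2) && (p.1 < q.1)%N.

Lemma revlex_trans n : transitive (@revlex n).
Proof.
by move=> [a b] [c d] [e f]; rewrite /revlex -!val_eqE /=; lia.
Qed.

Lemma revlex_asym n (p q : 'I_n * 'I_n) : revlex p q -> revlex q p = false.
Proof. by case: p q => [a b] [c d]; rewrite /revlex -!val_eqE /=; lia. Qed.

Lemma pairwise_enum_ord n : pairwise (fun i j : 'I_n => i < j)%N (enum 'I_n).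
Proof.
rewrite -(@pairwise_map _ _ val ltn) val_enum_ord -sorted_pairwise ?iota_ltn_sorted //.
exact: ltn_trans.
Qed.

Lemma pairwise_revlex n : pairwise (@revlex n) (revlex_pairs n).
Proof.
rewrite /revlex_pairs; have := pairwise_enum_ord n.
elim: (enum _) => //= j s IH /andP[js /IH{}IH].
rewrite pairwise_cat IH andbT; apply/andP; split.
  apply/allrelP => p q /mapP[i _ ->] /flatten_mapP[j' /(allP js) jj' /mapP[i' _ ->]].
  by rewrite /revlex /= jj'.
rewrite pairwise_map; apply: sub_pairwise (pairwise_filter _ (pairwise_enum_ord n)).
by move=> a b /= ab; rewrite /revlex /= eqxx ab orbT.
Qed.

Lemma mem_revlex_pairs n (p : 'I_n * 'I_n) : (p \in revlex_pairs n) = (p.1 < p.2)%N.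
Proof.
apply/flatten_mapP/idP => [[j _ /mapP[i]]|lt].
  by rewrite mem_filter => /andP[ij _] ->.
exists p.2; rewrite ?mem_enum //; apply/mapP; exists p.1; last by case: p lt.
by rewrite mem_filter lt mem_enum.
Qed.

Lemma uniq_revlex_pairs n : uniq (revlex_pairs n).
Proof.
apply: (pairwise_uniq _ (pairwise_revlex n)) => p.
by apply/negP => pp; have := revlex_asym pp; rewrite pp.
Qed.

Section Paths.
Variables (R : comNzRingType) (n : nat) (c : R).
Implicit Types (p q : 'I_n * 'I_n) (W : seq ('I_n * 'I_n)) (u v z : 'S_n).
Implicit Types (Q : pred ('I_n * 'I_n)).

(** Splits a path at its first edge; as [W] is sorted, the labels still available are those larger
    than the first one. *)
Lemma word_poly_pairwise W u v : pairwise (@revlex n) W ->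
  word_poly c W u v = (u == v)%:R + \sum_(q <- W | rising u q)
    c * word_poly c [seq r <- W | revlex q r] (u * swap q)%g v.
Proof.
elim: W u => [|p W IH] u; first by rewrite big_nil addr0 /word_poly /= ffunE.
rewrite pairwise_cons => /andP[pW pwW]; rewrite word_poly_cons (IH _ pwW) big_cons.
have pp : revlex p p = false by apply/negP => pp; have := revlex_asym pp; rewrite pp.
have -> : [seq r <- p :: W | revlex p r] = W by rewrite /= pp; apply/all_filterP.
have -> : \sum_(q <- W | rising u q)
     c * word_poly c [seq r <- p :: W | revlex q r] (u * swap q)%g v
  = \sum_(q <- W | rising u q) c * word_poly c [seq r <- W | revlex q r] (u * swap q)%g v.
  rewrite big_seq_cond [RHS]big_seq_cond; apply: eq_bigr => q /andP[/(allP pW) pq _] /=.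
  by rewrite (revlex_asym pq).
by case: ifP => _; rewrite ?addr0 // -addrA [X in _ + X]addrC.
Qed.

Definition suffix_poly p u v := word_poly c [seq r <- revlex_pairs n | revlex p r] u v.

(** The contribution of paths whose first step goes to [z]. Grouping by vertex instead of label lets
    [phi] match the terms. *)
Definition step_poly Q u z v := \sum_(q : 'I_n * 'I_n |
  [&& (q.1 < q.2)%N, Q q, rising u q & (u * swap q == z)%g]) c * suffix_poly q z v.

Lemma word_poly_step Q u v :
  (forall p q, Q p -> revlex p q -> Q q) ->
  word_poly c [seq r <- revlex_pairs n | Q r] u v
    = (u == v)%:R + \sum_z step_poly Q u z v.
Proof.
move=> Qup; rewrite word_poly_pairwise ?pairwise_filter ?pairwise_revlex //.
congr (_ + _); rewrite big_filter_cond big_mkcond big_uniq ?uniq_revlex_pairs //=.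
rewrite -big_mkcondr (partition_big (fun q => u * swap q)%g xpredT) //=.
apply: eq_bigr => z _; apply: eq_big => [q|q /andP[/and3P[_ Qq _] /eqP ->]].
  by rewrite mem_revlex_pairs -!andbA.
rewrite -filter_predI /suffix_poly; congr (_ * word_poly _ _ _ _).
apply: eq_filter => r /=; apply: andb_idr; exact: Qup.
Qed.

Lemma step_poly_edge Q u v q : (q.1 < q.2)%N -> rising u q ->
  step_poly Q u (u * swap q)%g v
    = if Q q then c * suffix_poly q (u * swap q)%g v else 0.
Proof.
move=> q12 up; have only (r : 'I_n * 'I_n) : [&& (r.1 < r.2)%N, Q r, rising u r &
    (u * swap r == u * swap q)%g] = Q q && (r == q).
  apply/and4P/andP => [[r12 Qr _ /eqP /mulgI sw]|[Qq /eqP ->]]; last by [].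
  by rewrite -(swap_inj r12 q12 sw).
rewrite /step_poly (eq_bigl _ _ only); case: (Q q); last by rewrite big_pred0.
exact: big_pred1_eq.
Qed.

Lemma step_poly_eq0 Q u z v : ~~ refl_lt u z -> step_poly Q u z v = 0.
Proof.
move=> nuz; apply: big_pred0 => q; apply/and4P => -[q12 _ up /eqP uqz].
by case/negP: nuz; rewrite -uqz refl_lt_swap.
Qed.

Lemma step_poly_not_bruhat Q u z v : ~~ bruhat z v -> step_poly Q u z v = 0.
Proof.
move=> nzv; apply: big1 => q _; rewrite /suffix_poly word_poly_eq0 ?mulr0 //.
by apply/allP => r; rewrite mem_filter mem_revlex_pairs => /andP[].
Qed.
End Paths.

Section Transport.
Variables (n1 n2 : nat) (s1 w1 : 'S_n1) (s2 w2 : 'S_n2) (phi : 'S_n1 -> 'S_n2).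
Hypothesis phi_iso : is_graph_iso s1 w1 s2 w2 phi.
Hypothesis phi_revlex : forall x (p q : 'I_n1 * 'I_n1) (p' q' : 'I_n2 * 'I_n2),
  (p.1 < p.2)%N -> (q.1 < q.2)%N -> (p'.1 < p'.2)%N -> (q'.1 < q'.2)%N ->
  bruhat_graph s1 w1 x (x * swap p)%g ->
  bruhat_graph s1 w1 (x * swap p)%g (x * swap p * swap q)%g ->
  phi (x * swap p)%g = (phi x * swap p')%g ->
  phi (x * swap p * swap q)%g = (phi x * swap p' * swap q')%g ->
  revlex p q = revlex p' q'.

Let phi_in x : x \in interval s1 w1 -> phi x \in interval s2 w2.
Proof. by case: phi_iso => <- _ _ xI; apply: imset_f. Qed.

Lemma interval_convex n (s w u v z : 'S_n) : u \in interval s w -> v \in interval s w ->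
  bruhat u z -> bruhat z v -> z \in interval s w.
Proof.
rewrite !inE => /andP[su _] /andP[_ vw] uz zv.
by rewrite (bruhat_trans su uz) (bruhat_trans zv vw).
Qed.

(** [Q1] and [Q2] are the labels still allowed after the previous edge, and they must agree on the
    edges leaving [u]. After a step along [q] they become the labels larger than [q], and
    [phi_revlex] supplies the agreement at the next vertex. *)
Lemma word_poly_transport k (Q1 : pred ('I_n1 * 'I_n1)) (Q2 : pred ('I_n2 * 'I_n2)) u v :
  (length w1 - length u < k)%N ->
  u \in interval s1 w1 -> v \in interval s1 w1 ->
  (forall p q, Q1 p -> revlex p q -> Q1 q) ->
  (forall p q, Q2 p -> revlex p q -> Q2 q) ->
  (forall (q : 'I_n1 * 'I_n1) (q' : 'I_n2 * 'I_n2), (q.1 < q.2)%N -> (q'.1 < q'.2)%N ->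
    bruhat_graph s1 w1 u (u * swap q)%g -> phi (u * swap q)%g = (phi u * swap q')%g ->
    Q1 q = Q2 q') ->
  word_poly ('X : {poly int}) [seq r <- revlex_pairs n1 | Q1 r] u v =
  word_poly 'X [seq r <- revlex_pairs n2 | Q2 r] (phi u) (phi v).
Proof.
case: phi_iso => phi_img phi_inj phi_edge.
elim: k Q1 Q2 u => // k IH Q1 Q2 u lt_k uI vI Q1up Q2up Q12.
have sum_interval m (s w x y : 'S_m) Q : x \in interval s w -> y \in interval s w ->
    \sum_z step_poly ('X : {poly int}) Q x z y
      = \sum_(z in interval s w) step_poly 'X Q x z y.
  move=> xI yI; rewrite [RHS]big_mkcond; apply: eq_bigr => z _; case: ifPn => // zI.
  (* A contributing vertex lies between [x] and [y], hence in the interval. *)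
  have [xz|/step_poly_eq0-> //] := boolP (refl_lt x z).
  rewrite step_poly_not_bruhat //; apply: contra zI.
  by apply: interval_convex xI yI _; apply: bruhat_edge.
rewrite !word_poly_step // (inj_in_eq phi_inj) //; congr (_ + _).
rewrite (sum_interval _ s1 w1) // (sum_interval _ s2 w2) ?phi_in // -phi_img big_imset //=.
apply: eq_bigr => z zI; have := phi_edge _ _ uI zI.
rewrite {2}/bruhat_graph {1}/bruhat_graph uI zI !phi_in //= => uz_edge.
have [uz|nuz] := boolP (refl_lt u z); last first.
  by rewrite !step_poly_eq0 // -uz_edge.
have /refl_ltP[q' [q'12 up' phizE]] : refl_lt (phi u) (phi z) by rewrite -uz_edge.
have /refl_ltP[q [q12 up zE]] := uz.
have uzG : bruhat_graph s1 w1 u z by rewrite /bruhat_graph uI zI.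
subst z; rewrite phizE !step_poly_edge // (Q12 q q') //; case: ifP => // _.
congr (_ * _); rewrite /suffix_poly -phizE; apply: IH => //; try exact: revlex_trans.
- have := length_swap_up q12 up; move: zI; rewrite inE => /andP[_ /bruhat_length_leq].
  by lia.
- by move=> p r pq qr; apply: revlex_trans pq qr.
- by move=> p r pq qr; apply: revlex_trans pq qr.
by move=> r r' r12 r'12 zrG; rewrite phizE => phir; apply: (phi_revlex q12 r12 q'12 r'12 uzG).
Qed.

Lemma Rtilde_transport u v : u \in interval s1 w1 -> v \in interval s1 w1 ->
  Rtilde u v = Rtilde (phi u) (phi v).
Proof.
move=> uI vI; rewrite /Rtilde -(filter_predT (revlex_pairs n1)) -(filter_predT (revlex_pairs n2)).
exact: (word_poly_transport (ltnSn _)).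
Qed.

Lemma bruhat_transport u v : u \in interval s1 w1 -> v \in interval s1 w1 ->
  bruhat (phi u) (phi v) = bruhat u v.
Proof. by move=> uI vI; rewrite -!Rtilde_neq0 Rtilde_transport. Qed.

Lemma length_transport u v : u \in interval s1 w1 -> v \in interval s1 w1 -> bruhat u v ->
  (length (phi v) - length (phi u) = length v - length u)%N.
Proof.
move=> uI vI uv; apply: succn_inj; rewrite -!size_Rtilde ?bruhat_transport //.
by rewrite Rtilde_transport.
Qed.

Lemma Rpoly_transport u v : u \in interval s1 w1 -> v \in interval s1 w1 -> bruhat u v ->
  Rpoly u v = Rpoly (phi u) (phi v).
Proof.
move=> uI vI uv; rewrite !Rpoly_dehom /Rdehom Rtilde_transport //.
by rewrite length_transport.
Qed.

Lemma interval_transport u v : u \in interval s1 w1 -> v \in interval s1 w1 ->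
  phi @: interval u v = interval (phi u) (phi v).
Proof.
case: phi_iso => phi_img phi_inj _ uI vI.
have sub z : z \in interval u v -> z \in interval s1 w1.
  by rewrite inE => /andP[]; apply: interval_convex.
apply/setP=> z'; apply/imsetP/idP => [[z zI ->]|z'I].
  have zI1 := sub z zI; rewrite inE !bruhat_transport //.
  by move: zI; rewrite inE.
have : z' \in interval s2 w2.
  by move: z'I; rewrite inE => /andP[]; apply: interval_convex; apply: phi_in.
rewrite -phi_img => /imsetP[z zI z'E]; exists z => //.
by move: z'I; rewrite z'E !inE !bruhat_transport.
Qed.

(** By induction on the length difference both sides solve the same reversal equation under the same
    degree bound. *)
Lemma KLpoly_transport u v : u \in interval s1 w1 -> v \in interval s1 w1 ->
  KLpoly u v = KLpoly (phi u) (phi v).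
Proof.
case: phi_iso => phi_img phi_inj _.
have [Pz1 Pd1 Ps1 Pr1] := KL_family_KLpoly n1.
have [Pz2 Pd2 Ps2 Pr2] := KL_family_KLpoly n2.
have [k] := ubnP (length v - length u)%N; elim: k u => // k IH u lt_k uI vI.
have [uv|nuv] := boolP (bruhat u v); last by rewrite Pz1 // Pz2 // bruhat_transport.
have [->|ne] := eqVneq u v; first by rewrite Pd1 Pd2.
have uv' : bruhat (phi u) (phi v) by rewrite bruhat_transport.
have ne' : phi u != phi v by rewrite (inj_in_eq phi_inj).
have RD m (x : 'S_m) : Rpoly x x = 1 by rewrite Rpoly_dehom Rdehom_diag.
apply: (@reversal_unique (length v - length u)
    _ _ (\sum_(a in interval u v | a != u) Rpoly u a * KLpoly a v)).
- exact: Ps1.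
- by rewrite -(length_transport uI vI uv); apply: Ps2.
- by rewrite Pr1 // interval_sum_split // RD mul1r.
rewrite -(length_transport uI vI uv) Pr2 // interval_sum_split // RD mul1r.
congr (_ + _); rewrite -interval_transport //.
rewrite big_mkcondr big_imset /=; last first.
  by apply: sub_in2 phi_inj => z; rewrite inE => /andP[]; apply: interval_convex.
rewrite [RHS]big_mkcondr; apply: eq_bigr => a aI.
have [ua av] : bruhat u a /\ bruhat a v by move: aI; rewrite inE => /andP[].
have aI1 : a \in interval s1 w1 by apply: interval_convex uI vI _ _.
rewrite (inj_in_eq phi_inj) //; case: ifP => // au.
rewrite Rpoly_transport // IH //.
move: (interval_above aI au) lt_k => [+ +]; clear; lia.
Qed.
End Transport.

(* Consecutive labels in one column, and the conclusion *)
Local Close Scope ring_scope.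

(* The two upward paths from x to y in the dihedral coset through x and y:   *)
(* one has both labels in column j; the other one has labels (j, < j) or     *)
(* (< j, j) according to whether the first path is increasing or not.        *)
Lemma same_column_increasing n (x : 'S_n) (p q : 'I_n * 'I_n) :
  (p.1 < p.2)%N -> (q.1 < q.2)%N -> p.2 = q.2 ->
  rising x p -> rising (x * swap p) q ->
  (p.1 < q.1)%N <-> exists r t : 'I_n * 'I_n,
    [/\ (r.1 < r.2)%N && (t.1 < t.2)%N, rising x r, rising (x * swap r) t,
        x * swap p * swap q = x * swap r * swap t
      & r.2 = p.2 /\ (t.2 < p.2)%N].
Proof.
case: p q => [i1 j] [i2 j'] /= lt1 lt2 j'E; subst j'.
have [i1j i2j] : i1 != j /\ i2 != j by split; rewrite -val_eqE neq_ltn ?lt1 ?lt2.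
have [ji1 ji2] : j != i1 /\ j != i2 by split; rewrite eq_sym.
move=> up1 up; have i12 : i1 != i2.
  by apply: contraTneq up => <-; rewrite rising_swap // negbK.
have i21 : i2 != i1 by rewrite eq_sym.
(* After the first edge the value j stands where i1 stood, so in x the values occur in the order i2,
   i1, j. *)
have up2 : (x^-1 i2 < x^-1 i1)%N.
  by move: up; rewrite /rising /= !pos_swap /swap /= tpermR tpermD.
split=> [lt12|].
  exists (i2, j), (i1, i2); split=> //=.
  - by rewrite lt2.
  - exact: ltn_trans up2 up1.
  - by rewrite /rising /= !pos_swap /swap /= tpermL tpermD.
  rewrite -!mulgA; congr (_ * _); rewrite /swap /= [LHS]conjgC.
  by rewrite tpermJ tpermD // tpermR.
case=> -[i3 j3] [[i4 j4]] [/= /andP[lt3 lt4] _ up4 eq_prod [j3E lt_j4]].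
(* If i2 < i1, comparing the two products at i2 and at j forces r = (i2, j) and t = (i2, i1), and
   then t is not rising. *)
subst j3; rewrite ltnNge; apply/negP => le21.
have lt21 : (i2 < i1)%N by rewrite ltn_neqAle val_eqE i21.
move: eq_prod; rewrite -!mulgA => /mulgI/permP eq_prod.
have j_fix : swap (i4, j4) j = j.
  by rewrite /swap tpermD // -val_eqE neq_ltn /= ?lt_j4 // (ltn_trans lt4).
have i32 : i3 = i2.
  apply: (@perm_inj _ (swap (i3, j) * swap (i4, j4))); rewrite -(eq_prod i2) !permM.
  have -> : swap (i3, j) i3 = j by apply: tpermL.
  by rewrite j_fix /swap /= (tpermD i12 ji2) tpermL.
subst i3; have := eq_prod j; rewrite !permM /swap /= !tpermR (tpermD i21 ji1) => i2_i1.
have [i4E j4E] : i4 = i2 /\ j4 = i1.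
  move: i2_i1; case: tpermP => [-> -> //|i2E i1E |_ _ /eqP].
    by move: lt4; rewrite -i2E -i1E ltnNge le21.
  by rewrite (negbTE i12).
move: up4; rewrite i4E j4E /rising /= !pos_swap /swap /= tpermL tpermD //.
by rewrite ltnNge ltnW.
Qed.

Theorem theorem5p8 (n1 n2 : nat) (sigma1 omega1 : 'S_n1) (sigma2 omega2 : 'S_n2)
    (phi : 'S_n1 -> 'S_n2) (gamma : 'I_n1 -> 'I_n2)
    (hphi : is_graph_iso sigma1 omega1 sigma2 omega2 phi)
    (hgamma : forall i j : 'I_n1, (i < j)%N -> (gamma i < gamma j)%N)
    (hedge : forall (z : 'S_n1) (i j : 'I_n1) (i' j' : 'I_n2),
       (i < j)%N -> (i' < j')%N ->
       bruhat_graph sigma1 omega1 z (z * tperm i j)%g ->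
       phi (z * tperm i j)%g = (phi z * tperm i' j')%g ->
       j' = gamma j) :
  KLpoly sigma1 omega1 = KLpoly sigma2 omega2.
Proof.
have [phi_img phi_inj phi_edge] := hphi.
have lt_gamma i j : (gamma i < gamma j)%N = (i < j)%N.
  have [/hgamma -> //|/hgamma|/val_inj ->] := ltngtP i j; last by rewrite ltnn.
  by move=> lt_ji; rewrite ltnNge ltnW.
have gamma_inj : injective gamma.
  move=> i j eq_ij; have := lt_gamma i j; have := lt_gamma j i.
  by rewrite eq_ij ltnn; case: ltngtP => // /val_inj.
have phi_in z : z \in interval sigma1 omega1 -> phi z \in interval sigma2 omega2.
  by move=> zI; rewrite -phi_img imset_f.
have label z (p : 'I_n1 * 'I_n1) (p' : 'I_n2 * 'I_n2) : (p.1 < p.2)%N -> (p'.1 < p'.2)%N ->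
    bruhat_graph sigma1 omega1 z (z * swap p) ->
    phi (z * swap p) = phi z * swap p' -> p'.2 = gamma p.2.
  by move=> p12 p'12; apply: hedge.
have edgeP m (s w z : 'S_m) (p : 'I_m * 'I_m) : (p.1 < p.2)%N ->
    bruhat_graph s w z (z * swap p) ->
    [/\ z \in interval s w, z * swap p \in interval s w & rising z p].
  by move=> p12 /and3P[zI zpI]; rewrite refl_lt_swap.
have phi_revlex x (p q : 'I_n1 * 'I_n1) (p' q' : 'I_n2 * 'I_n2) :
  (p.1 < p.2)%N -> (q.1 < q.2)%N -> (p'.1 < p'.2)%N -> (q'.1 < q'.2)%N ->
  bruhat_graph sigma1 omega1 x (x * swap p)%g ->
  bruhat_graph sigma1 omega1 (x * swap p)%g (x * swap p * swap q)%g ->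
  phi (x * swap p)%g = (phi x * swap p')%g ->
  phi (x * swap p * swap q)%g = (phi x * swap p' * swap q')%g ->
  revlex p q = revlex p' q'.
  move=> p12 q12 p'12 q'12 xy yz phi_xy phi_xz.
  have phi_yz : phi (x * swap p * swap q) = phi (x * swap p) * swap q' by rewrite phi_xy.
  have p'2 := label _ _ _ p12 p'12 xy phi_xy; have q'2 := label _ _ _ q12 q'12 yz phi_yz.
  have [xI yI up_p] := edgeP _ _ _ _ _ p12 xy.
  have [_ zI up_q] := edgeP _ _ _ _ _ q12 yz.
  have := xy; have := yz; rewrite !phi_edge // phi_xz phi_xy => yz' xy'.
  have [xI' yI' up_p'] := edgeP _ _ _ _ _ p'12 xy'.
  have [_ zI' up_q'] := edgeP _ _ _ _ _ q'12 yz'.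
  rewrite /revlex p'2 q'2 lt_gamma (inj_eq gamma_inj); congr (_ || _).
  have [pq2|//] := eqVneq p.2 q.2; rewrite /=.
  have pq'2 : p'.2 = q'.2 by rewrite p'2 q'2 pq2.
  have inc := same_column_increasing p12 q12 pq2 up_p up_q.
  have inc' := same_column_increasing p'12 q'12 pq'2 up_p' up_q'.
  (* The companion path exists on one side and is carried across [phi]: forwards by the edge
     relation, backwards because [phi] is onto the second interval. [gamma] transfers the order of
     its columns. *)
  apply/idP/idP => [/inc|/inc'] [r [t [/andP[r12 t12] up_r up_t eq_z [r2 t2]]]].
    have xb : bruhat x (x * swap r) by apply: bruhat_edge; rewrite refl_lt_swap.
    have bz : bruhat (x * swap r) (x * swap r * swap t).
      by apply: bruhat_edge; rewrite refl_lt_swap.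
    have bI : x * swap r \in interval sigma1 omega1.
      by apply: (interval_convex xI zI) => //; rewrite eq_z.
    have gxb : bruhat_graph sigma1 omega1 x (x * swap r).
      by rewrite /bruhat_graph xI bI refl_lt_swap.
    have gbz : bruhat_graph sigma1 omega1 (x * swap r) (x * swap r * swap t).
      by rewrite /bruhat_graph bI -eq_z zI /= eq_z refl_lt_swap.
    have [gxb' gbz'] := (gxb, gbz); rewrite !phi_edge // -?eq_z // in gxb' gbz'.
    have /and3P[_ _ /refl_ltP[r' [r'12 up_r' bE]]] := gxb'.
    have /and3P[_ _ /refl_ltP[t' [t'12 up_t' zE]]] := gbz'.
    apply/inc'; exists r', t'; split=> //; first by rewrite r'12.
    - by rewrite -bE.
    - by rewrite -bE -zE phi_xz.
    rewrite (label _ _ _ r12 r'12 gxb bE) (label _ _ _ t12 t'12 gbz) -?eq_z //.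
    by rewrite r2 p'2 lt_gamma.
  have xb : bruhat (phi x) (phi x * swap r) by apply: bruhat_edge; rewrite refl_lt_swap.
  have bz : bruhat (phi x * swap r) (phi x * swap r * swap t).
    by apply: bruhat_edge; rewrite refl_lt_swap.
  have : phi x * swap r \in interval sigma2 omega2.
    by apply: (interval_convex xI' zI') => //; rewrite eq_z.
  rewrite -phi_img => /imsetP[b bI bE].
  have gxb : bruhat_graph sigma1 omega1 x b.
    by rewrite phi_edge // /bruhat_graph !phi_in // -bE refl_lt_swap.
  have gbz : bruhat_graph sigma1 omega1 b (x * swap p * swap q).
    by rewrite phi_edge // /bruhat_graph !phi_in //= phi_xz eq_z -bE refl_lt_swap.
  have /and3P[_ _ /refl_ltP[r' [r'12 up_r' bE']]] := gxb.
  have /and3P[_ _ /refl_ltP[t' [t'12 up_t' zE']]] := gbz.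
  have r'2 : r.2 = gamma r'.2.
    by apply: (label x) => //; rewrite -bE'.
  have t'2 : t.2 = gamma t'.2.
    by apply: (label b) => //; rewrite -zE' // -bE -eq_z phi_xz.
  apply/inc; exists r', t'; split=> //; first by rewrite r'12.
  - by rewrite -bE'.
  - by rewrite -bE'.
  move: r2 t2; rewrite r'2 t'2 p'2 lt_gamma => r2 t2.
  by split=> //; apply: gamma_inj.
(* If [sigma1] is not below [omega1], both intervals are empty and both polynomials vanish. *)
have [so|nso] := boolP (bruhat sigma1 omega1); last first.
  have [Pz1 _ _ _] := KL_family_KLpoly n1; have [Pz2 _ _ _] := KL_family_KLpoly n2.
  rewrite Pz1 // Pz2 //; apply: contra nso => so2.
  have : sigma2 \in interval sigma2 omega2 by rewrite inE bruhat_refl.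
  by rewrite -phi_img => /imsetP[z]; rewrite inE => /andP[sz zo] _; apply: bruhat_trans sz zo.
have sI : sigma1 \in interval sigma1 omega1 by rewrite inE bruhat_refl.
have oI : omega1 \in interval sigma1 omega1 by rewrite inE so bruhat_refl.
have bT := bruhat_transport hphi phi_revlex.
have [s2_le le_o2] : bruhat sigma2 (phi sigma1) /\ bruhat (phi omega1) omega2.
  by have := phi_in _ sI; have := phi_in _ oI; rewrite !inE => /andP[_ ->] /andP[->].
have so2 : bruhat sigma2 omega2.
  by apply: bruhat_trans s2_le (bruhat_trans _ le_o2); rewrite bT.
(* Since [phi] respects the Bruhat order, it matches least elements and, below, greatest
   elements. *)
have phi_s : phi sigma1 = sigma2.
  have : sigma2 \in interval sigma2 omega2 by rewrite inE bruhat_refl.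
  rewrite -phi_img => /imsetP[z zI zE]; apply: bruhat_anti => //; rewrite zE bT //.
  by move: zI; rewrite inE => /andP[].
have phi_o : phi omega1 = omega2.
  have : omega2 \in interval sigma2 omega2 by rewrite inE so2 bruhat_refl.
  rewrite -phi_img => /imsetP[z zI zE]; apply: bruhat_anti => //; rewrite zE bT //.
  by move: zI; rewrite inE => /andP[].
by rewrite (KLpoly_transport hphi phi_revlex sI oI) phi_s phi_o.
Qed.
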